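(* Let $n,m,k$ be positive integers with $2\le k\le\min\{n,m\}$, and let $F,G\colon\mathbb R^{m\times n}\to\mathbb R$ be continuous functions such that: $G$ is a null Lagrangian; $F$ and $G$ are positively homogeneous of degree $k$; $\sup\{K\ge 0: F(\zeta)\ge KG(\zeta)\ \text{for all }\zeta\in\mathbb R^{m\times n}\}=1$; and $c_F:=\inf\{F(\zeta):\zeta\in\mathbb R^{m\times n},\ |\zeta|=1\}>0$. Let $K\ge1$, and let $q(F,G,K)$ be a lower regularity exponent for $(F,G,K)$ (as defined in the context). Let $V\subset\mathbb R^n$ be a domain and let $E$ be a closed subset of $V$ with Hausdorff dimension $\dim_H(E)<n-q(F,G,K)$. Then every bounded mapping $v\in W^{1,k}_{\mathrm{loc}}(V\setminus E;\mathbb R^m)$ satisfying $$F(v'(x))\le K\,G(v'(x))\quad\text{for a.e. }x\in V\setminus E$$ can be extended to a mapping of the class $W^{1,k}_{\mathrm{loc}}(V;\mathbb R^m)$ which is defined over the whole domain $V$ and satisfies the same inequality $F(v'(x))\le K\,G(v'(x))$ for a.e. $x\in V$.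
   Context: $\mathbb R^{m\times n}$ is the space of real $m\times n$ matrices, with operator norm $|\zeta|:=\sup\{|\zeta(x)|:x\in\mathbb R^n,|x|<1\}$. $v'(x)=(\partial v_\mu/\partial x_\nu(x))$ is the (weak) Jacobian matrix. For scalar $\varphi$, $v\otimes\varphi'$ is the matrix $(v_\mu\,\partial\varphi/\partial x_\nu)_{\mu,\nu}$. A function $\Phi$ on a real vector space is positively homogeneous of degree $p$ if $\Phi(tx)=t^p\Phi(x)$ for all $t>0$, $x\ne0$. A continuous $F\colon\mathbb R^{m\times n}\to\mathbb R$ is quasiconvex if $|B(0,1)|F(\zeta)\le\int_{B(0,1)}F(\zeta+\varphi'(x))\,dx$ for all $\varphi\in C_0^\infty(B(0,1);\mathbb R^m)$, $\zeta\in\mathbb R^{m\times n}$. $G$ is a null Lagrangian if both $G$ and $-G$ are quasiconvex. Lower regularity exponent: given $F,G$ and $K\ge1$, a number $q=q(F,G,K)$ is a lower regularity exponent for $(F,G,K)$ if $1<q<k$ and there is a number $\bar p=p(F,G,K)>k$ such that for every $r>q$, every open $W\subset\mathbb R^n$ and every $w\in W^{1,r}_{\mathrm{loc}}(W;\mathbb R^m)$ with $F(w')\le KG(w')$ a.e. in $W$, one has $w\in W^{1,s}_{\mathrm{loc}}(W;\mathbb R^m)$ for all $s\in(q,\bar p)$ and $\|\varphi w'\|_{L^s(W;\mathbb R^{m\times n})}\le C(F,G,K,s)\|w\otimes\varphi'\|_{L^s(W;\mathbb R^{m\times n})}$ for all $\varphi\in C_0^\infty(W)$, $s\in(q,\bar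 p)$, with $C(F,G,K,s)>0$ independent of $W,w,\varphi$. The paper's self-improving regularity theorem states that such an exponent exists for every $K\ge1$ whenever $n,m,k$ are positive integers with $2\le k\le\min\{n,m\}$ and $F,G\colon\mathbb R^{m\times n}\to\mathbb R$ are continuous functions such that $G$ is a null Lagrangian, $F$ and $G$ are positively homogeneous of degree $k$, $\sup\{L\ge0:F(\zeta)\ge LG(\zeta)\ \text{for all }\zeta\in\mathbb R^{m\times n}\}=1$, and $\inf\{F(\zeta):\zeta\in\mathbb R^{m\times n},\ |\zeta|=1\}>0$. *)

(* Defs.v *)
From HB Require Import structures.
From mathcomp Require Import all_boot all_order all_algebra.
From mathcomp Require Import all_classical all_reals all_analysis.
Set Implicit Arguments.
Unset Strict Implicit.
Unset Printing Implicit Defensive.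
Import Order.TTheory GRing.Theory Num.Theory.
Import numFieldNormedType.Exports.
Local Open Scope classical_set_scope.
Local Open Scope ring_scope.

(* Points of R^n are column vectors. The norm that the library puts on
   matrices is the sup norm; it is used only for its topology. *)

Definition enorm (R : realType) (n : nat) (x : 'cV[R]_n) : R :=
  Num.sqrt (\sum_i x i 0 ^+ 2).

Definition opnorm (R : realType) (m n : nat) (A : 'M[R]_(m, n)) : R :=
  sup [set enorm (A *m x) | x in [set x : 'cV[R]_n | enorm x < 1]].

Definition eball (R : realType) (n : nat) : set 'cV[R]_n :=
  [set x | enorm x < 1].

(* Lebesgue measure on R^n: the outer measure given by countable (possibly
   finite) coverings by boxes, restricted to its Caratheodory sigma-algebra.
   A box is coded by its two extreme corners; it may be empty, in which case
   one of the factors of its volume is 0. *)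

Definition box (R : realType) (n : nat) (B : 'cV[R]_n * 'cV[R]_n) :
    set 'cV[R]_n :=
  [set x | forall i, B.1 i 0 <= x i 0 <= B.2 i 0].

Definition box_vol (R : realType) (n : nat) (B : 'cV[R]_n * 'cV[R]_n) : R :=
  \prod_i Num.max 0 (B.2 i 0 - B.1 i 0).

Definition box_cover (R : realType) (n : nat) (A : set 'cV[R]_n) :
    set (set ('cV[R]_n * 'cV[R]_n)) :=
  [set C | countable C /\ A `<=` \bigcup_(B in C) box B].

Definition lebesgue_outer (R : realType) (n : nat) (A : set 'cV[R]_n) :
    \bar R :=
  ereal_inf [set \esum_(B in C) (box_vol B)%:E | C in box_cover A].

Lemma box_vol_ge0 (R : realType) (n : nat) (B : 'cV[R]_n * 'cV[R]_n) :
  (0 <= (box_vol B)%:E)%E.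
Proof. by rewrite lee_fin; apply: prodr_ge0 => i _; rewrite le_max lexx. Qed.

Lemma lebesgue_outer_ge0 (R : realType) (n : nat) (A : set 'cV[R]_n) :
  (0 <= lebesgue_outer A)%E.
Proof.
apply: le_ereal_inf_tmp => _ [C _ <-].
by apply: esum_ge0 => B _; exact: box_vol_ge0.
Qed.

Lemma lebesgue_outer0 (R : realType) (n : nat) :
  lebesgue_outer (set0 : set 'cV[R]_n) = 0%E.
Proof.
apply/eqP; rewrite eq_le lebesgue_outer_ge0 andbT.
apply: ereal_inf_lbound; exists set0; last by rewrite esum_set0.
by split => //; exact: countable0.
Qed.

Lemma le_lebesgue_outer (R : realType) (n : nat) :
  {homo @lebesgue_outer R n : A B / A `<=` B >-> (A <= B)%E}.
Proof.
move=> A B AB; apply/ereal_inf_le_tmp => _ [C [cC BC] <-].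
by exists C => //; split => //; exact: subset_trans BC.
Qed.

Lemma lebesgue_outer_sigma_subadditive (R : realType) (n : nat) :
  sigma_subadditive (@lebesgue_outer R n).
Proof.
move=> A; have [[i ioo]|] := pselect (exists i, lebesgue_outer (A i) = +oo%E).
  rewrite (eseries_pinfty _ _ ioo) ?leey// => j _.
  by rewrite -ltNye (lt_le_trans _ (lebesgue_outer_ge0 _)).
rewrite -forallNE => Aoo.
suff add2e (e : {posnum R}) : (lebesgue_outer (\bigcup_j A j) <=
    \sum_(i <oo) lebesgue_outer (A i) + e%:num%:E)%E.
  by apply/lee_addgt0Pr => _/posnumP[].
rewrite (le_trans _ (epsilon_trick _ _ _))//; last first.
  by move=> j; exact: lebesgue_outer_ge0.
pose P j (C : set ('cV[R]_n * 'cV[R]_n)) := box_cover (A j) C /\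
  (\esum_(B in C) (box_vol B)%:E <=
     lebesgue_outer (A j) + (e%:num / (2 ^ j.+1)%:R)%:E)%E.
have [G PG] : {G : nat -> set ('cV[R]_n * 'cV[R]_n) & forall j, P j (G j)}.
  apply: (@choice _ _ P) => j; rewrite /P.
  have fA : lebesgue_outer (A j) \is a fin_num.
    rewrite ge0_fin_numE ?lebesgue_outer_ge0// ltey; apply/eqP; exact: Aoo.
  have en1 : (0 < e%:num / (2 ^ j.+1)%:R :> R) by [].
  have [_ [C cC <-] xS] := lb_ereal_inf_adherent en1 fA.
  by exists C; split => //; exact/ltW.
apply: (@le_trans _ _ (\esum_(B in \bigcup_j G j) (box_vol B)%:E)%E).
  apply: ereal_inf_lbound; exists (\bigcup_j G j) => //; split.
    by apply: bigcup_countable => // j _; have [[]] := PG j.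
  move=> x [j _ Ajx]; have [[_ sAG] _] := PG j.
  by have [B GB Bx] := sAG _ Ajx; exists B => //; exists j.
rewrite seqDU_bigcup_eq esum_bigcupT//; last by move=> B; exact: box_vol_ge0.
rewrite -nneseries_esumT; last first.
  by move=> j; apply: esum_ge0 => B _; exact: box_vol_ge0.
apply: lee_nneseries => [j _ _|j _].
  by apply: esum_ge0 => B _; exact: box_vol_ge0.
have [_ +] := PG j; apply: le_trans.
rewrite ge_ereal_sup => //= _ [X [finX XI]] <-; apply: esum_ge.
by exists X => //; split => //; apply: subset_trans XI _; exact: subset_seqDU.
Qed.

HB.instance Definition _ (R : realType) (n : nat) :=
  isOuterMeasure.Build R 'cV[R]_n (@lebesgue_outer R n)
    (@lebesgue_outer0 R n) (@lebesgue_outer_ge0 R n)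
    (@le_lebesgue_outer R n) (@lebesgue_outer_sigma_subadditive R n).

(* convertible to 'cV[R]_n, but carrying the Lebesgue sigma-algebra *)
Notation lebesgue_space R n := (caratheodory_type (@lebesgue_outer R n)).

Definition lebesgue (R : realType) (n : nat) :
    set (lebesgue_space R n) -> \bar R :=
  @lebesgue_outer R n.

HB.instance Definition _ (R : realType) (n : nat) :=
  isMeasure.Build _ _ _ (@lebesgue R n)
    (@caratheodory_measure0 R _ (@lebesgue_outer R n))
    (@caratheodory_measure_ge0 R _ (@lebesgue_outer R n))
    (@caratheodory_measure_sigma_additive R _ (@lebesgue_outer R n)).

Arguments lebesgue {R n}.

Definition ediam (R : realType) (n : nat) (U : set 'cV[R]_n) : \bar R :=
  maxe 0%E (ereal_sup [set (enorm (x.1 - x.2))%:E | x in U `*` U]).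

Definition hausdorff_pre (R : realType) (n : nat) (s delta : R)
    (A : set 'cV[R]_n) : \bar R :=
  ereal_inf [set (\sum_(0 <= i <oo) (ediam (U i) `^ s)%E)%E |
    U in [set U : (set 'cV[R]_n)^nat |
      A `<=` \bigcup_i U i /\ forall i, (ediam (U i) <= delta%:E)%E]].

Definition hausdorff (R : realType) (n : nat) (s : R) (A : set 'cV[R]_n) :
    \bar R :=
  ereal_sup [set hausdorff_pre s delta A | delta in [set d : R | 0 < d]].

(* The exponent s = 0, which does not affect the infimum, is left out because
   0 `^ 0 = 1 would count the empty pieces of a covering. *)
Definition hausdorff_dim (R : realType) (n : nat) (A : set 'cV[R]_n) :
    \bar R :=
  ereal_inf [set s%:E | s in [set s : R | 0 < s /\ hausdorff s A = 0%E]].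

Definition partial (R : realType) (n : nat) (i : 'I_n) (f : 'cV[R]_n -> R^o) :
    'cV[R]_n -> R^o :=
  'D_(delta_mx i 0) f.

Definition smooth (R : realType) (n : nat) (f : 'cV[R]_n -> R^o) : Prop :=
  forall s : seq 'I_n, let g := foldr (@partial R n) f s in
    continuous g /\ forall x i, derivable g x (delta_mx i 0).

Definition test_function (R : realType) (n : nat) (W : set 'cV[R]_n)
    (phi : 'cV[R]_n -> R^o) : Prop :=
  let S := closure [set x | phi x != 0] in
  [/\ smooth phi, compact S & S `<=` W].

Definition jacobian_mx (R : realType) (m n : nat)
    (phi : 'cV[R]_n -> 'cV[R]_m) (x : 'cV[R]_n) : 'M[R]_(m, n) :=
  \matrix_(i, j) partial j (fun y => phi y i 0) x.

Definition quasiconvex (R : realType) (m n : nat) (F : 'M[R]_(m, n) -> R) :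
    Prop :=
  continuous F /\
  forall (phi : 'cV[R]_n -> 'cV[R]_m) (A : 'M[R]_(m, n)),
    (forall i, test_function (@eball R n) (fun x => phi x i 0)) ->
    (lebesgue (@eball R n) * (F A)%:E <=
      \int[lebesgue]_(x in @eball R n) (F (A + jacobian_mx phi x))%:E)%E.

Definition null_lagrangian (R : realType) (m n : nat)
    (G : 'M[R]_(m, n) -> R) : Prop :=
  quasiconvex G /\ quasiconvex (fun A => - G A).

Definition pos_homogeneous (R : realType) (m n : nat) (p : nat)
    (F : 'M[R]_(m, n) -> R) : Prop :=
  forall (t : R) (A : 'M[R]_(m, n)), 0 < t -> A != 0 ->
    F (t *: A) = t ^+ p * F A.

Definition Lp_loc (R : realType) (n : nat) (r : R) (W : set 'cV[R]_n)
    (f : 'cV[R]_n -> R) : Prop :=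
  measurable_fun (W : set (lebesgue_space R n)) f /\
  forall C : set 'cV[R]_n, compact C -> C `<=` W ->
    (\int[lebesgue]_(x in C) (`|f x| `^ r)%:E < +oo)%E.

Definition weak_partial (R : realType) (n : nat) (W : set 'cV[R]_n)
    (j : 'I_n) (f g : 'cV[R]_n -> R) : Prop :=
  forall phi, test_function W phi ->
    (\int[lebesgue]_(x in W) (f x * partial j phi x)%:E =
      - \int[lebesgue]_(x in W) (g x * phi x)%:E)%E.

(* w belongs to W^{1,r}_loc(W; R^m) and has the weak Jacobian matrix w'
   (which w determines up to a null set of W). Functions on W are total
   functions whose values outside W are irrelevant. *)
Definition sobolev_loc (R : realType) (m n : nat) (r : R) (W : set 'cV[R]_n)
    (w : 'cV[R]_n -> 'cV[R]_m) (w' : 'cV[R]_n -> 'M[R]_(m, n)) : Prop :=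
  [/\ forall i, Lp_loc r W (fun x => w x i 0),
      forall i j, Lp_loc r W (fun x => w' x i j) &
      forall i j, weak_partial W j (fun x => w x i 0) (fun x => w' x i j)].

Definition ae_in (R : realType) (n : nat) (W : set 'cV[R]_n)
    (P : 'cV[R]_n -> Prop) : Prop :=
  {ae @lebesgue R n, forall x, W x -> P x}.

Definition tensor_grad (R : realType) (m n : nat) (w : 'cV[R]_n -> 'cV[R]_m)
    (phi : 'cV[R]_n -> R^o) (x : 'cV[R]_n) : 'M[R]_(m, n) :=
  \matrix_(i, j) (w x i 0 * partial j phi x).

Definition Lnorm_mx (R : realType) (m n : nat) (s : R) (W : set 'cV[R]_n)
    (f : 'cV[R]_n -> 'M[R]_(m, n)) : \bar R :=
  'N[@lebesgue R n]_(s%:E)[((fun x => (opnorm (f x))%:E) \_ W)%FUN]%E.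

Definition lower_regularity_exponent (R : realType) (m n k : nat)
    (F G : 'M[R]_(m, n) -> R) (K q : R) : Prop :=
  1 < q < k%:R /\
  exists pbar : R, k%:R < pbar /\
  exists c : R -> R, (forall s, q < s < pbar -> 0 < c s) /\
  forall (r : R) (W : set 'cV[R]_n)
      (w : 'cV[R]_n -> 'cV[R]_m) (w' : 'cV[R]_n -> 'M[R]_(m, n)),
    q < r -> open W -> sobolev_loc r W w w' ->
    ae_in W (fun x => F (w' x) <= K * G (w' x)) ->
    forall s, q < s < pbar ->
      sobolev_loc s W w w' /\
      forall phi, test_function W phi ->
        (Lnorm_mx s W (fun x => phi x *: w' x) <=
          (c s)%:E * Lnorm_mx s W (tensor_grad w phi))%E.

(* Main.v *)
Require Import Defs.
From mathcomp Require Import all_boot all_order all_algebra.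
From mathcomp Require Import all_classical all_reals all_analysis.
From mathcomp Require Import measurable_realfun ring lra.
Set Implicit Arguments.
Unset Strict Implicit.
Unset Printing Implicit Defensive.
Import Order.TTheory GRing.Theory Num.Theory.
Import numFieldNormedType.Exports.
Local Open Scope classical_set_scope.
Local Open Scope ring_scope.

(** The mapping v is its own extension. As dim_H E < n - q, there are exponents
    s and r with H^s(E) = 0, q < r < k and s <= n - r. In particular E is a
    Lebesgue null set, so that v and v' are defined almost everywhere in V, and
    the inequality F(v') <= K G(v') holds almost everywhere in V. It remains to
    see that v has the weak derivative v' in V and that v' is locally
    L^r-integrable in V ([removable]): the lower regularity exponent, used in V,
    then improves r to k.

    The lower regularity exponent, used in V \ E, provides the Caccioppoli
    inequality ||psi v'||_r <= C ||v (x) psi'||_r for all test functions psi on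
    V \ E. Let phi be a test function on V. Since H^s(E) = 0 and s <= n - r, the
    compact set T of the points of E in the support of phi has zero r-capacity:
    there are smooth functions chi that vanish near T, tend to 1 off T, and whose
    gradients are small in L^r and in L^1 ([null_cutoff]). For psi = phi chi, the
    Caccioppoli inequality and the boundedness of v bound phi chi v' in L^r
    independently of chi, and Fatou's lemma bounds phi v' ([removable_energy]).
    Knowing this, one lets chi tend to 1 in the integration by parts formula for
    the test function phi chi on V \ E. The additional term v phi chi' tends to 0
    in L^1, again because v is bounded ([removable_by_parts]).

    The function chi is the product of the 1 - theta_i^k, where theta_i is a bump
    function that is 1 on the i-th cube of a finite cover of T by cubes of radii
    rho_i for which the sum of the rho_i^s is small. The r-th power of the
    gradient of theta_i has an integral of order rho_i^(n - r) <= rho_i^s. The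
    gradient of chi is a sum of as many terms as there are cubes, and the cubes
    may overlap. Still its r-th power is at most k^r times the sum of the r-th
    powers of the gradients of the theta_i ([prod_derive_powR_le]): by Hölder's
    inequality and r <= k this follows from the fact that the sum over i of
    theta_i^k times the product of the other 1 - theta_j^k is the probability
    that exactly one of a family of independent events occurs. *)

(** * Lebesgue measurability of open sets *)

(** Stated for sets of vectors, so that the topology and the set operations of
    R^n apply to them directly. *)
Definition lmeasurable (R : realType) (n : nat) (A : set 'cV[R]_n) : Prop :=
  @measurable _ (lebesgue_space R n) A.

Section LebesgueOuter.
Context {R : realType} {n : nat}.
Implicit Types (A : set 'cV[R]_n) (B : 'cV[R]_n * 'cV[R]_n).

Lemma lebesgue_outer_box B : (lebesgue_outer (box B) <= (box_vol B)%:E)%E.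
Proof.
apply: ereal_inf_lbound; exists [set B]; last first.
  by rewrite esum_set1// box_vol_ge0.
by split; [exact: countable1 | move=> x Bx; exists B].
Qed.

(** Countable subadditivity for a family that is indexed by a countable set of
    boxes, as a cover is, and not by the natural numbers. *)
Lemma lebesgue_outer_countable_cover A (C : set ('cV[R]_n * 'cV[R]_n))
    (f : 'cV[R]_n * 'cV[R]_n -> set 'cV[R]_n) :
  countable C -> A `<=` \bigcup_(B in C) f B ->
  (lebesgue_outer A <= \esum_(B in C) lebesgue_outer (f B))%E.
Proof.
move=> /pcard_leP[g] AC.
pose J i := C `&` g @^-1` [set i].
have CJ : C = \bigcup_i J i.
  by apply/seteqP; split=> [B CB|B [i _ []]//]; exists (g B).
have tJ : trivIset setT J by move=> i j _ _ [B [[_ <-] [_ <-]]].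
rewrite [X in \esum_(_ in X) _]CJ esum_bigcupT//; last first.
  by move=> B; exact: lebesgue_outer_ge0.
rewrite -nneseries_esumT; last first.
  by move=> i; apply: esum_ge0 => B _; exact: lebesgue_outer_ge0.
apply: (@le_trans _ _ (\sum_(0 <= i <oo)
    lebesgue_outer (\bigcup_(B in J i) f B))%E); last first.
  apply: lee_nneseries => [i _ _|i _]; first exact: lebesgue_outer_ge0.
  have [->|/set0P[B JB]] := eqVneq (J i) set0.
    by rewrite bigcup_set0 esum_set0 lebesgue_outer0.
  have -> : J i = [set B].
    apply/seteqP; split=> [B' [CB' gB']|_ ->//]; case: JB => CB gB /=.
    by apply: (@inj _ _ _ g); [exact: mem_set|exact: mem_set|exact: (etrans gB' (esym gB))].
  rewrite bigcup_set1 esum_set1//; exact: lebesgue_outer_ge0.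
apply: le_trans (lebesgue_outer_sigma_subadditive _).
apply: le_lebesgue_outer => x /AC[B CB fx]; exists (g B) => //.
by exists B => //; split.
Qed.

(** The parts of the box coded by [B] on the two sides of the hyperplane
    x_i = c. *)
Definition cut_le (i : 'I_n) (c : R) B : 'cV[R]_n * 'cV[R]_n :=
  (B.1, \col_j (if j == i then Num.min (B.2 j 0) c else B.2 j 0)).
Definition cut_ge (i : 'I_n) (c : R) B : 'cV[R]_n * 'cV[R]_n :=
  (\col_j (if j == i then Num.max (B.1 j 0) c else B.1 j 0), B.2).

Lemma box_vol_cut i c B :
  box_vol (cut_le i c B) + box_vol (cut_ge i c B) = box_vol B.
Proof.
rewrite /box_vol /= (bigD1 i)//= [X in _ + X](bigD1 i)//= [RHS](bigD1 i)//=.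
rewrite !mxE eqxx.
under eq_bigr => j /negPf ji do rewrite !mxE ji.
under [X in _ + _ * X]eq_bigr => j /negPf ji do rewrite !mxE ji.
rewrite -mulrDl; congr (_ * _).
move: (B.1 i 0) (B.2 i 0) => a b.
case: (leP b c) => bc; case: (leP a c) => ac; do ?case: leP => ?; lra.
Qed.

(** A hyperplane cuts each box of a cover into two boxes whose volumes add up to
    that of the box, so half-spaces satisfy Caratheodory's criterion. *)
Lemma le_halfspace_measurable (i : 'I_n) (c : R) :
  lmeasurable [set x : 'cV[R]_n | x i 0 <= c].
Proof.
apply: le_caratheodory_measurable => X.
change (lebesgue_outer ((X : set 'cV[R]_n) `&` [set x : 'cV[R]_n | (x i 0 <= c)%R]) +
  lebesgue_outer (X `&` ~` [set x : 'cV[R]_n | (x i 0 <= c)%R]) <= lebesgue_outer X)%E.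
apply: le_ereal_inf_tmp => _ [C [cC XC] <-].
apply: (@le_trans _ _ (\esum_(B in C) (box_vol (cut_le i c B))%:E +
    \esum_(B in C) (box_vol (cut_ge i c B))%:E)%E); last first.
  rewrite -esumD; try by move=> *; exact: box_vol_ge0.
  by apply: le_esum => B _; rewrite -EFinD box_vol_cut.
apply: leeD.
  refine (le_trans (@lebesgue_outer_countable_cover _ C (fun B => box (cut_le i c B)) cC _) _).
    move=> x [/XC[B CB Bx] xi]; exists B => //= j; rewrite !mxE.
    by case: eqVneq => [->|_]; [rewrite le_min andbA xi andbT|]; exact: Bx.
  by apply: le_esum => B _; exact: lebesgue_outer_box.
apply: (@le_trans _ _ _ _ _ (@lebesgue_outer_countable_cover _ C
  (fun B => box (cut_ge i c B)) cC _)).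
  move=> x [/XC[B CB Bx] /negP]; rewrite -ltNge => xi; exists B => //= j; rewrite !mxE.
  case: eqVneq => [->|_]; last exact: Bx.
  by rewrite ge_max (ltW xi) andbT; exact: Bx.
by apply: le_esum => B _; exact: lebesgue_outer_box.
Qed.

Lemma gt_halfspace_measurable (i : 'I_n) (c : R) :
  lmeasurable [set x : 'cV[R]_n | c < x i 0].
Proof.
rewrite (_ : mkset _ = ~` [set x : 'cV[R]_n | x i 0 <= c]).
  by apply: measurableC; exact: le_halfspace_measurable.
by apply/seteqP; split => x /=; rewrite ltNge => /negP.
Qed.

Lemma lt_halfspace_measurable (i : 'I_n) (c : R) :
  lmeasurable [set x : 'cV[R]_n | x i 0 < c].
Proof.
rewrite (_ : mkset _ = \bigcup_k [set x : 'cV[R]_n | x i 0 <= c - k.+1%:R^-1]).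
  by apply: bigcup_measurable => k _; exact: le_halfspace_measurable.
apply/seteqP; split => [x /= xc|x [k _] /= xck].
  have [k kx] := @ltr_add_invr _ _ _ xc.
  exists k => //=; rewrite lerBrDr; exact: ltW.
by apply: le_lt_trans xck _; rewrite ltrBlDr ltrDl invr_gt0.
Qed.

Definition ratbox (p : 'cV[rat]_n * 'cV[rat]_n) : set 'cV[R]_n :=
  [set x | forall i, ratr (p.1 i 0) < x i 0 < ratr (p.2 i 0)].

Lemma ratbox_measurable p : lmeasurable (ratbox p).
Proof.
rewrite (_ : ratbox p = \bigcap_(i in [set: 'I_n])
    ([set x | ratr (p.1 i 0) < x i 0] `&` [set x | x i 0 < ratr (p.2 i 0)])).
  apply: fin_bigcap_measurable => // i _; apply: measurableI.
    exact: gt_halfspace_measurable.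
  exact: lt_halfspace_measurable.
apply/seteqP; split => [x px i _|x px i] /=; first by have /andP := px i.
by have [/= -> ->] := px i Logic.I.
Qed.

Lemma open_ratboxE (U : set 'cV[R]_n) : open U ->
  U = \bigcup_(p in [set p | ratbox p `<=` U]) ratbox p.
Proof.
move=> oU; apply/seteqP; split => [x Ux|x [p pU px]]; last exact: pU.
have /nbhs_ballP[e /= e0 xeU] : nbhs x U by exact: open_nbhs_nbhs.
have xr i : exists q : rat, x i 0 - e < ratr q < x i 0.
  have [q] := @rat_in_itvoo R (x i 0 - e) (x i 0) ltac:(by rewrite gtrBl).
  by rewrite in_itv; exists q.
have xl i : exists q : rat, x i 0 < ratr q < x i 0 + e.
  have [q] := @rat_in_itvoo R (x i 0) (x i 0 + e) ltac:(by rewrite ltrDl).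
  by rewrite in_itv; exists q.
have [f fP] := choice xr; have [g gP] := choice xl.
exists (\col_i f i, \col_i g i).
  move=> y yfg; apply: xeU; split=> // i j; rewrite (ord1 j) /ball/=.
  have := yfg i; rewrite !mxE => /andP[fy yg].
  have /andP[fx _] := fP i; have /andP[_ gx] := gP i.
  by rewrite ltr_norml; apply/andP; split; lra.
move=> i; rewrite /= !mxE.
by have /andP[_ ->] := fP i; have /andP[-> _] := gP i.
Qed.

(** An open set is a countable union of open boxes with rational corners, and
    these are finite intersections of half-spaces. *)
Lemma open_lebesgue_measurable (U : set 'cV[R]_n) :
  open U -> lmeasurable U.
Proof.
move=> /open_ratboxE ->.
rewrite (_ : bigcup _ _ = \bigcup_k
    (if unpickle k is Some p then if `[< ratbox p `<=` U >] then ratbox p else set0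
     else set0)).
  apply: bigcup_measurable => k _; case: unpickle => // p.
  by case: ifP => // _; exact: ratbox_measurable.
apply/seteqP; split=> [x [p /= pU px]|x [k _]].
  by exists (pickle p) => //; rewrite pickleK; case: asboolP.
by case: unpickle => // p; case: asboolP => // pU px; exists p.
Qed.

Lemma closed_lebesgue_measurable (U : set 'cV[R]_n) :
  closed U -> lmeasurable U.
Proof.
move=> cU; rewrite -[U]setCK; apply: measurableC.
by apply: open_lebesgue_measurable; exact: closed_openC.
Qed.

Lemma continuous_lebesgue_measurable (f : 'cV[R]_n -> R^o) :
  continuous f ->
  measurable_fun setT (f : lebesgue_space R n -> R).
Proof.
move=> cf; apply: (measurability _ (RGenOInfty.measurableE R)).
move=> _ [_ [a ->] <-]; rewrite setTI; apply: open_lebesgue_measurable.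
by apply: open_comp => // x _; exact: cf.
Qed.

Lemma null_lebesgue_measurable (A : set 'cV[R]_n) :
  lebesgue_outer A = 0%E -> lmeasurable A.
Proof.
move=> A0; apply: le_caratheodory_measurable => X.
rewrite [X in (X + _)%E](_ : _ = 0%E) ?add0e.
  exact: le_lebesgue_outer.
apply/eqP; rewrite eq_le lebesgue_outer_ge0 andbT -A0.
exact: le_lebesgue_outer.
Qed.

End LebesgueOuter.

(** * Smooth functions of one variable *)

Section SmoothOneVariable.
Context {R : realType}.

(** The function t^(-m) exp(-1/t), extended by 0 to t <= 0. The linear span of
    these functions is closed under differentiation. *)
Definition flat (m : nat) (t : R) : R :=
  if 0 < t then t^-1 ^+ m * expR (- t^-1) else 0.

Lemma flat_le0 m t : t <= 0 -> flat m t = 0.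
Proof. by rewrite /flat ltNge => ->. Qed.

Lemma flat_ge0 m t : 0 <= flat m t.
Proof.
by rewrite /flat; case: ltP => // t0; rewrite mulr_ge0 ?expR_ge0// exprn_ge0 ?invr_ge0 ?ltW.
Qed.

Lemma flat0_gt0 t : 0 < t -> 0 < flat 0 t.
Proof. by rewrite /flat => ->; rewrite expr0 mul1r expR_gt0. Qed.

(** This is exp x >= x^(m+1) / (m+1)! at x = 1/t. The difference quotients of
    [flat m] at 0 are values of [flat m.+1], hence tend to 0. *)
Lemma flat_le m t : 0 < t -> flat m t <= m.+1`!%:R * t.
Proof.
move=> t0; rewrite /flat t0.
have ti : 0 <= t^-1 by rewrite invr_ge0 ltW.
have h := @expR_ge1Dxn R t^-1 m ti.
rewrite expRN ler_pdivrMr ?expR_gt0//.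
rewrite -ler_pdivrMl; last by rewrite mulr_gt0// ltr0n fact_gt0.
apply: le_trans h; rewrite (_ : _ * _ = t^-1 ^+ m.+1 / m.+1`!%:R).
  by rewrite lerDr.
by rewrite invfM exprS; ring.
Qed.

Lemma is_derive_flat m (t : R) :
  is_derive t (1 : R) (flat m) (flat m.+2 t - m%:R * flat m.+1 t).
Proof.
have [t0|t0|->] := ltrgtP t 0.
- have n0 : \forall s \near t, cst 0 s = flat m s.
    near=> s; rewrite /= flat_le0//; apply: ltW; near: s; exact: lt_nbhsl.
  rewrite !flat_le0 ?ltW// mulr0 subr0.
  exact: near_eq_is_derive n0 (is_derive_cst _ _ _).
- have n0 : \forall s \near t, s^-1 ^+ m * expR (- s^-1) = flat m s.
    near=> s; rewrite /flat ifT//; near: s; apply: open_nbhs_nbhs; split=> //; exact: open_gt.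
  have tn0 : t != 0 by rewrite gt_eqF.
  have dV : is_derive t (1 : R) (fun s : R => s^-1) (- t ^- 2 *: 1).
    exact: is_deriveV.
  have dX := is_deriveX m dV.
  have dE : is_derive t (1 : R) (fun s : R => expR (- s^-1)) _ :=
    @is_derive1_comp R expR (fun s => - s^-1) t _ _ (is_derive_expR (- t^-1)) (is_deriveN dV).
  have := is_deriveM dX dE.
  rewrite exprfctE => h; apply: (near_eq_is_derive n0).
  apply: is_derive_eq h _; rewrite /flat t0 /GRing.scale/=.
  rewrite -exprVn; move: (t^-1) => u; move: (expR _) => e.
  case: m {n0 dX} => [|m] /=; first by ring.
  by rewrite !exprS -natr1; ring.
- rewrite !flat_le0// mulr0 subr0.
  suff h : (fun h : R => h^-1 *: ((flat m \o shift 0) (h *: 1) - flat m 0)) @ 0^' --> (0 : R).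
    apply: DeriveDef; first by apply/cvg_ex; exists 0.
    exact: cvg_lim h.
  apply/cvgr0Pnorm_le => e e0; near=> h.
  rewrite /= addr0 (@flat_le0 m 0)// subr0 /GRing.scale/= mulr1.
  have [h0|h0] := leP h 0; first by rewrite flat_le0// mulr0 normr0 ltW.
  rewrite (_ : _ * _ = flat m.+1 h); last first.
    by rewrite /flat h0 mulrA -exprS.
  rewrite ger0_norm ?flat_ge0//; apply: le_trans (flat_le _ h0) _.
  rewrite -ler_pdivlMl ?ltr0n ?fact_gt0//; apply: le_trans (ler_norm _) _.
  near: h; apply: dnbhs0_le.
  by rewrite mulr_gt0// invr_gt0 ltr0n fact_gt0.
Unshelve. all: by end_near. Qed.

(** Smoothness is obtained by membership in an explicit class of differentiable
    functions that contains the derivatives of its members. *)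
Inductive elementary : (R -> R) -> Prop :=
| elementary_cst c : elementary (fun=> c)
| elementary_flat m : elementary (flat m)
| elementary_add f g : elementary f -> elementary g ->
    elementary (fun t => f t + g t)
| elementary_mul f g : elementary f -> elementary g ->
    elementary (fun t => f t * g t)
| elementary_inv f : elementary f -> (forall t, 0 < f t) ->
    elementary (fun t => (f t)^-1)
| elementary_affine f c d : elementary f -> elementary (fun t => f (c * t + d)).

Lemma elementary_derive f : elementary f -> exists f' : R -> R,
  elementary f' /\ forall t : R, is_derive t (1 : R) f (f' t).
Proof.
elim=> {f}.
- by move=> c; exists (fun=> 0); split=> [|t]; [exact: elementary_cst|exact: is_derive_cst].
- move=> m; exists (fun t => flat m.+2 t + (fun t => (- m%:R) * flat m.+1 t) t).
  split=> [|t]; last by rewrite mulNr; exact: is_derive_flat.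
  apply: elementary_add; first exact: elementary_flat.
  by apply: elementary_mul; [exact: elementary_cst|exact: elementary_flat].
- move=> f g _ [f' [ef df]] _ [g' [eg dg]].
  exists (fun t => f' t + g' t); split=> [|t]; first exact: elementary_add.
  exact: is_deriveD.
- move=> f g ef [f' [ef' df]] eg [g' [eg' dg]].
  exists (fun t => f t * g' t + g t * f' t); split=> [|t].
    by apply: elementary_add; exact: elementary_mul.
  exact: is_deriveM.
- move=> f ef [f' [ef' df]] f0.
  exists (fun t => ((fun=> -1) t * ((f t)^-1 * (f t)^-1)) * f' t); split=> [|t].
    apply: elementary_mul => //; apply: elementary_mul; first exact: elementary_cst.
    by apply: elementary_mul; exact: elementary_inv.
  rewrite mulN1r -expr2 exprVn; apply: is_deriveV => //.
  by rewrite gt_eqF.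
- move=> f c d ef [f' [ef' df]].
  exists (fun t => f' (c * t + d) * (fun=> c) t); split=> [|t].
    apply: elementary_mul; last exact: elementary_cst.
    exact: elementary_affine.
  apply: (@is_derive1_comp _ f (fun t => c * t + d)) => //.
  apply: is_derive_eq; rewrite /GRing.scale/=; ring.
Qed.

Lemma elementary_continuous f : elementary f -> continuous f.
Proof.
move=> /elementary_derive[f' [_ df]] t.
by apply/differentiable_continuous/derivable1_diffP; case: (df t).
Qed.

Definition step (t : R) : R := flat 0 t * (flat 0 t + flat 0 (-1 * t + 1))^-1.

Let step_den t : 0 < flat 0 t + flat 0 (-1 * t + 1).
Proof.
have [t0|t0] := leP t 0.
  by apply: ltr_wpDl; rewrite ?flat_ge0// flat0_gt0//; lra.
by apply: ltr_wpDr; rewrite ?flat_ge0// flat0_gt0.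
Qed.

Lemma elementary_step : elementary step.
Proof.
apply: elementary_mul; first exact: elementary_flat.
apply: elementary_inv step_den; apply: elementary_add; first exact: elementary_flat.
by apply: elementary_affine; exact: elementary_flat.
Qed.

Lemma step_le0 t : t <= 0 -> step t = 0.
Proof. by move=> t0; rewrite /step flat_le0// mul0r. Qed.

Lemma step_ge1 t : 1 <= t -> step t = 1.
Proof.
move=> t1; rewrite /step (@flat_le0 0 (-1 * t + 1)); last lra.
by rewrite addr0 mulfV// gt_eqF// flat0_gt0//; lra.
Qed.

Lemma step01 t : 0 <= step t <= 1.
Proof.
rewrite /step mulr_ge0 ?flat_ge0 ?invr_ge0 ?(ltW (step_den t))//=.
by rewrite ler_pdivrMr ?step_den// mul1r lerDl flat_ge0.
Qed.

(** Equal to 1 on [-1, 1] and to 0 off [-2, 2]. *)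
Definition plateau (t : R) : R := step (1 * t + 2) * step (-1 * t + 2).

Lemma elementary_plateau : elementary plateau.
Proof.
by apply: elementary_mul; apply: elementary_affine; exact: elementary_step.
Qed.

Lemma plateau01 t : 0 <= plateau t <= 1.
Proof.
have /andP[a0 a1] := step01 (1 * t + 2); have /andP[b0 b1] := step01 (-1 * t + 2).
by rewrite /plateau mulr_ge0//= mulr_ile1.
Qed.

Lemma plateau1 t : `|t| <= 1 -> plateau t = 1.
Proof. by rewrite ler_norml => /andP[? ?]; rewrite /plateau !step_ge1 ?mulr1//; lra. Qed.

Lemma plateau0 t : 2 <= `|t| -> plateau t = 0.
Proof.
rewrite /plateau ler_normr => /orP[h|h].
  by rewrite (@step_le0 (-1 * t + 2)) ?mulr0//; lra.
by rewrite (@step_le0 (1 * t + 2)) ?mul0r//; lra.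
Qed.

(** The derivative is continuous and vanishes off the compact [-2, 2], hence is
    bounded. *)
Lemma plateau_derive : exists (theta' : R -> R) (L : R),
  [/\ elementary theta', forall t : R, is_derive t (1 : R) plateau (theta' t),
      0 < L, forall t, `|theta' t| <= L & forall t, 2 < `|t| -> theta' t = 0].
Proof.
have [f' [ef df]] := elementary_derive elementary_plateau.
have z t : 2 < `|t| -> f' t = 0.
  move=> t2; have n0 : \forall s \near t, cst 0 s = plateau s.
    near=> s; rewrite /= plateau0//; apply: ltW; near: s.
    apply: open_nbhs_nbhs; split => //; apply: open_comp (@open_gt _ 2) => ? _.
    exact: norm_continuous.
  have [_ <-] := near_eq_is_derive n0 (is_derive_cst (0 : R) _ (1 : R)).
  by have [_ ->] := df t.
have [c cI cmax] := @EVT_max R (fun t => `|f' t|) (-2) 2 ltac:(lra) ltac:(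
  apply: continuous_subspaceT => t; apply: (@continuous_comp _ _ _ f' Num.norm);
    [exact: elementary_continuous|exact: norm_continuous]).
exists f', (1 + `|f' c|); split=> // t.
have [t2|/z ->] := leP `|t| 2; last by rewrite normr0 addr_ge0.
apply: le_trans (cmax t _) _; last by rewrite lerDr.
by rewrite in_itv/=; rewrite ler_norml in t2.
Unshelve. all: by end_near. Qed.

End SmoothOneVariable.

(** * Smooth functions of several variables *)

(** [smooth] and [partial] for functions whose codomain is seen as [R], the
    ring, instead of [R^o], the module. *)
Definition smoothR (R : realType) (n : nat) (f : 'cV[R]_n -> R) : Prop :=
  smooth f.

Definition partialR (R : realType) (n : nat) (i : 'I_n) (f : 'cV[R]_n -> R) :
  'cV[R]_n -> R := partial i f.

Section SmoothFunctions.
Context {R : realType} {n : nat}.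
Implicit Types f g : 'cV[R]_n -> R^o.

Lemma smooth_continuous f : smooth f -> continuous f.
Proof. by move=> sf; have [] := sf [::]. Qed.

Lemma smooth_derivable f i x : smooth f -> derivable f x (delta_mx i 0).
Proof. by move=> sf; have [_] := sf [::]; apply. Qed.

Lemma smooth_partial f i : smooth f -> smooth (partial i f).
Proof. by move=> sf s; have := sf (rcons s i); rewrite foldr_rcons. Qed.

(** Smoothness is the largest property of continuous functions with partial
    derivatives that these derivatives inherit. *)
Lemma smooth_coind (P : ('cV[R]_n -> R^o) -> Prop) :
  (forall f, P f -> [/\ continuous f,
     forall x i, derivable f x (delta_mx i 0) & forall i, P (partial i f)]) ->
  forall f, P f -> smooth f.
Proof.
move=> hP f Pf s.
suff Pg : P (foldr (@partial R n) f s) by have [? ? _] := hP _ Pg.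
by elim: s => //= i s Ps; have [_ _] := hP _ Ps; apply.
Qed.

(** The ring generated by the smooth functions: by the Leibniz rule it contains
    the partial derivatives of its members, so it consists of smooth functions. *)
Inductive smooth_ring : ('cV[R]_n -> R^o) -> Prop :=
| smooth_ring_base f : smooth f -> smooth_ring f
| smooth_ring_add f g : smooth_ring f -> smooth_ring g -> smooth_ring (f \+ g)
| smooth_ring_mul f g : smooth_ring f -> smooth_ring g -> smooth_ring (f \* g).

Lemma smooth_ring_smooth f : smooth_ring f -> smooth f.
Proof.
apply: smooth_coind f => f.
elim=> {f} [f sf|f g _ [cf df pf] _ [cg dg pg]|f g rf [cf df pf] rg [cg dg pg]].
- split=> [|x i|i]; first exact: smooth_continuous.
    exact: smooth_derivable.
  by apply: smooth_ring_base; exact: smooth_partial.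
- split=> [x|x i|i]; first by apply: continuousD; [exact: cf|exact: cg].
    exact: derivableD.
  rewrite (_ : partial i _ = partial i f \+ partial i g); first exact: smooth_ring_add.
  by apply/funext => x; rewrite /partial deriveD.
- split=> [x|x i|i]; first by apply: continuousM; [exact: cf|exact: cg].
    exact: derivableM.
  rewrite (_ : partial i _ = (f \* partial i g) \+ (g \* partial i f)).
    by apply: smooth_ring_add; exact: smooth_ring_mul.
  by apply/funext => x; rewrite /partial deriveM.
Qed.

End SmoothFunctions.

Section SmoothCalculus.
Context {R : realType} {n : nat}.
Implicit Types f g : 'cV[R]_n -> R.

Lemma smoothR_continuous f : smoothR f -> continuous f.
Proof. exact: smooth_continuous. Qed.

Lemma smoothR_partialR f i : smoothR f -> smoothR (partialR i f).
Proof. exact: smooth_partial. Qed.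

Lemma smoothD f g : smoothR f -> smoothR g -> smoothR (fun x => f x + g x).
Proof.
move=> sf sg.
exact: (smooth_ring_smooth (smooth_ring_add (smooth_ring_base sf) (smooth_ring_base sg))).
Qed.

Lemma smoothM f g : smoothR f -> smoothR g -> smoothR (fun x => f x * g x).
Proof.
move=> sf sg.
exact: (smooth_ring_smooth (smooth_ring_mul (smooth_ring_base sf) (smooth_ring_base sg))).
Qed.

Lemma partialM f g i x : smoothR f -> smoothR g ->
  partialR i (fun x => f x * g x) x = f x * partialR i g x + g x * partialR i f x.
Proof.
move=> sf sg.
exact (deriveM (smooth_derivable sf) (smooth_derivable sg)).
Qed.

Lemma partialD f g i x : smoothR f -> smoothR g ->
  partialR i (fun x => f x + g x) x = partialR i f x + partialR i g x.
Proof.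
move=> sf sg.
exact (deriveD (smooth_derivable sf) (smooth_derivable sg)).
Qed.

Lemma is_derive_coord (g : R -> R) (g' : R -> R) (i j : 'I_n) (x : 'cV[R]_n) :
  (forall t : R, is_derive t (1 : R) g (g' t)) ->
  is_derive x (delta_mx i 0) ((fun x => g (x j 0)) : 'cV[R]_n -> R^o)
    ((i == j)%:R * g' (x j 0)).
Proof.
move=> dg; have [ij|ij] := eqVneq i j.
  rewrite mul1r; have [dgx <-] := dg (x j 0).
  suff E : (fun h : R => h^-1 *: (((fun x : 'cV[R]_n => g (x j 0)) \o shift x)
      (h *: delta_mx i 0) - g (x j 0))) =
    (fun h : R => h^-1 *: ((g \o shift (x j 0)) (h *: 1) - g (x j 0))).
    apply: DeriveDef; first by rewrite /derivable E.
    by rewrite /derive E.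
  apply/funext => h; rewrite /= !mxE ij !eqxx.
  by congr (_ *: (g _ - _)); rewrite /GRing.scale/=.
rewrite mul0r.
suff E : (fun h : R => h^-1 *: (((fun x : 'cV[R]_n => g (x j 0)) \o shift x)
      (h *: delta_mx i 0) - g (x j 0))) = cst (0 : R).
  have h : (fun h : R => h^-1 *: (((fun x : 'cV[R]_n => g (x j 0)) \o shift x)
      (h *: delta_mx i 0) - g (x j 0))) @ 0^' --> (0 : R).
    by rewrite E; exact: cvg_cst.
  apply: DeriveDef; first by apply/cvg_ex; exists 0.
  exact: cvg_lim h.
apply/funext => h; rewrite /= !mxE (negPf (_ : j != i)) 1?eq_sym//=.
by rewrite mulr0 add0r subrr scaler0.
Qed.

Lemma smooth_coord (g : R -> R) (j : 'I_n) :
  elementary g -> smoothR (fun x => g (x j 0)).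
Proof.
move=> eg; pose P f := exists2 g : R -> R, elementary g & f = (fun x => g (x j 0)).
rewrite /smoothR; apply: (@smooth_coind _ _ P); last by exists g.
move=> _ [{eg} {}g eg ->].
have [g' [eg' dg]] := elementary_derive eg.
split=> [x|x i|i].
- apply: continuous_comp; first exact: coord_continuous.
  exact: elementary_continuous.
- by have [] := is_derive_coord i j x dg.
- exists (fun t => (fun=> (i == j)%:R) t * g' t).
    by apply: elementary_mul => //; exact: elementary_cst.
  by apply/funext => x; have [_] := is_derive_coord i j x dg.
Qed.

Lemma smooth_cst (c : R) : @smoothR R n (fun=> c).
Proof.
rewrite /smoothR; apply: (@smooth_coind _ _ (fun f => exists c : R, f = (fun=> c))).
  2: by exists c.
move=> _ [{}c ->]; split=> [|x i|i]; first exact: cst_continuous.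
  exact: derivable_cst.
by exists 0; apply/funext => x; rewrite /partialR /partial derive_cst.
Qed.

Lemma partial_cst (c : R) i (x : 'cV[R]_n) : partialR i (fun=> c) x = 0.
Proof. by rewrite /partialR /partial derive_cst. Qed.

Lemma eq_smooth f g : f =1 g -> smoothR f -> smoothR g.
Proof. by move=> /funext ->. Qed.

Lemma eq_partial f g i x : f =1 g -> partialR i f x = partialR i g x.
Proof. by move=> /funext ->. Qed.

Lemma smooth_prod I (r : seq I) (P : pred I) (F : I -> 'cV[R]_n -> R) :
  (forall i, smoothR (F i)) -> smoothR (fun x => \prod_(i <- r | P i) F i x).
Proof.
move=> sF; elim: r => [|i r ih].
  by apply: eq_smooth (smooth_cst 1) => x; rewrite big_nil.
case Pi: (P i); last by apply: eq_smooth ih => x; rewrite big_cons Pi.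
by apply: eq_smooth (smoothM (sF i) ih) => x; rewrite big_cons Pi.
Qed.

Lemma smoothX f k : smoothR f -> smoothR (fun x => f x ^+ k).
Proof.
move=> sf; elim: k => [|k ih]; last first.
  by apply: eq_smooth (smoothM sf ih) => x; rewrite exprS.
by apply: eq_smooth (smooth_cst 1) => x; rewrite expr0.
Qed.

Lemma partialX f k i x : smoothR f ->
  partialR i (fun x => f x ^+ k) x = k%:R * f x ^+ k.-1 * partialR i f x.
Proof.
move=> sf; elim: k => [|k ih].
  have -> : (fun x => f x ^+ 0) = (fun=> 1) by apply/funext => y; rewrite expr0.
  by rewrite partial_cst !mul0r.
rewrite (@eq_partial _ (fun y => f y * (fun y => f y ^+ k) y)); last first.
  by move=> y; rewrite exprS.
have sfk := smoothX k sf.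
have := partialM i x sf sfk; rewrite {}ih => ->.
case: k {sfk} => [|k] /=; first by ring.
by rewrite exprS -[in RHS]natr1; ring.
Qed.

Lemma smoothN f : smoothR f -> smoothR (fun x => - f x).
Proof.
move=> sf; have h := smoothM (smooth_cst (-1)) sf.
by apply: eq_smooth h => x; rewrite mulN1r.
Qed.

Lemma partialN f i x : smoothR f -> partialR i (fun x => - f x) x = - partialR i f x.
Proof.
move=> sf; have := partialM i x (smooth_cst (-1)) sf.
rewrite partial_cst mulr0 addr0 mulN1r => <-.
by apply: eq_partial => y; rewrite mulN1r.
Qed.

Lemma smooth_1B f : smoothR f -> smoothR (fun x => 1 - f x).
Proof. by move=> sf; exact: (smoothD (smooth_cst 1) (smoothN sf)). Qed.

Lemma partial_1B f i x : smoothR f -> partialR i (fun x => 1 - f x) x = - partialR i f x.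
Proof.
move=> sf; have := partialD i x (smooth_cst 1) (smoothN sf).
by rewrite partial_cst partialN// add0r.
Qed.

End SmoothCalculus.

(** * The gradient of a product of many cutoff functions *)

Section ProductGradient.
Context {R : realType}.
Variables (k : nat) (r : R).
Hypotheses (k1 : (1 < k)%N) (r1 : 1 < r) (rk : r <= k%:R).
Variables (t d : nat -> R).
Hypothesis t01 : forall i, 0 <= t i <= 1.

Let P N := \prod_(i < N) (1 - t i ^+ k).

(** The value that the product rule gives for the derivative of [P N] when
    [d i] is the derivative of [t i]. *)
Fixpoint prod_derive N : R := match N with
  | 0 => 0
  | N'.+1 => P N' * (- (k%:R * t N' ^+ k.-1 * d N')) + (1 - t N' ^+ k) * prod_derive N'
  end.

(** The probability that exactly one of [N] independent events of
    probabilities [t i ^+ k] happens. *)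
Fixpoint exactly_one N : R := match N with
  | 0 => 0
  | N'.+1 => t N' ^+ k * P N' + (1 - t N' ^+ k) * exactly_one N'
  end.

Let tk01 i : 0 <= t i ^+ k <= 1.
Proof. by have /andP[? ?] := t01 i; rewrite exprn_ge0//= exprn_ile1. Qed.

Let P01 N : 0 <= P N <= 1.
Proof.
apply/andP; split.
  by apply: prodr_ge0 => i _; rewrite subr_ge0; have /andP[] := tk01 i.
apply: prodr_ile1 => i _; have /andP[a b] := tk01 i.
by rewrite subr_ge0 gerBl a b.
Qed.

Lemma exactly_one_ge0 N : 0 <= exactly_one N.
Proof.
elim: N => //= N ih; have /andP[? ?] := tk01 N; have /andP[? ?] := P01 N.
by rewrite addr_ge0// mulr_ge0// subr_ge0.
Qed.

Lemma exactly_one_le1 N : exactly_one N <= 1.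
Proof.
suff : P N + exactly_one N <= 1.
  by move=> h; apply: le_trans h; rewrite lerDr; have /andP[] := P01 N.
elim: N => /= [|N ih]; first by rewrite /P big_ord0 addr0.
rewrite /P big_ord_recr/= -/(P N); have /andP[a b] := tk01 N.
have /andP[p0 p1] := P01 N; have q0 := exactly_one_ge0 N.
by nra.
Qed.

Lemma prod_derive_le N : `|prod_derive N| <= k%:R * \sum_(i < N) `|d i|.
Proof.
elim: N => /= [|N ih]; first by rewrite big_ord0 mulr0 normr0.
rewrite big_ord_recr/= mulrDr addrC; apply: le_trans (ler_normD _ _) _.
have /andP[? ?] := tk01 N; have /andP[? ?] := P01 N; have /andP[? ?] := t01 N.
apply: lerD.
  rewrite normrM ger0_norm ?subr_ge0//.
  apply: le_trans _ ih; rewrite ler_piMl// gerBl//.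
rewrite normrM normrN !normrM (ger0_norm (_ : 0 <= P N))// normr_nat.
rewrite (ger0_norm (exprn_ge0 _ _))//.
rewrite -mulrA mulrCA ler_wpM2l//; apply: le_trans (_ : P N * `|d N| <= _).
  by rewrite ler_wpM2l// ler_piMl// exprn_ile1.
by rewrite ler_piMl.
Qed.

(* the exponent conjugate to r *)
Local Notation r' := (r / (r - 1)).
Let r'0 : 0 < r'.
Proof. by have := r1 => r1'; rewrite divr_gt0//; lra. Qed.
Let conj_expE : r^-1 + r'^-1 = 1.
Proof. by have := r1 => r1'; field; rewrite gt_eqF/= ?gt_eqF//; lra. Qed.

(** Here [r <= k] is what turns the r'-th power of [t N ^+ k.-1] into at most
    [t N ^+ k]: it means that [k <= (k - 1) * r']. *)
Lemma young_exactly_one N (y : R) : 0 <= y ->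
  t N ^+ k.-1 * P N * y <= t N ^+ k * P N / r' + y `^ r / r.
Proof.
have := r1 => r1' y0; have /andP[? ?] := P01 N; have /andP[? ?] := t01 N.
have u0 : 0 <= t N ^+ k.-1 * P N by rewrite mulr_ge0// exprn_ge0.
apply: le_trans (@conjugate_powR R _ _ r' r u0 y0 r'0 _ _) _; first by lra.
  by rewrite addrC conj_expE.
rewrite lerD2r ler_wpM2r ?invr_ge0 ?(ltW r'0)//.
rewrite powRM ?exprn_ge0// ler_pM ?powR_ge0//.
  rewrite -powR_mulrn// -powRrM -powR_mulrn//.
  have [->|tn0] := eqVneq (t N) 0.
    rewrite powR0; last by rewrite mulf_neq0 ?(gt_eqF r'0)// pnatr_eq0; case: k k1 => [|[]].
    exact: powR_ge0.
  apply: ger_powR; first by rewrite lt_neqAle eq_sym tn0; apply/andP.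
  rewrite mulrA ler_pdivlMr ?subr_gt0//.
  have -> : k.-1%:R = k%:R - 1 :> R.
    by case: k k1 => // k' _; rewrite -natr1 addrK.
  by have := rk => rk'; nra.
have [->|pn0] := eqVneq (P N) 0; first by rewrite powR0// (gt_eqF r'0).
apply: ge1r_powR; first by rewrite lt_neqAle eq_sym pn0; apply/andP.
by rewrite ler_pdivlMr; lra.
Qed.

(** Hölder's inequality in the additive form that is stable under the recursion
    of [prod_derive]; the parameter [a] is to be optimized. *)
Lemma prod_derive_young N (a : R) : 0 < a ->
  `|prod_derive N| <= k%:R * a *
     ((\sum_(i < N) (`|d i| / a) `^ r) / r + exactly_one N / r').
Proof.
have := r1 => r1' a0; elim: N => /= [|N ih].
  by rewrite normr0 big_ord0 !mul0r addr0 mulr0.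
have /andP[? ?] := tk01 N; have /andP[? ?] := P01 N; have /andP[? ?] := t01 N.
rewrite big_ord_recr/=.
have y0 : 0 <= `|d N| / a by rewrite divr_ge0 ?normr_ge0 ?(ltW a0).
have := young_exactly_one N y0.
set y := _ `^ r; set S := \sum_(i < N) _ in ih *; set Q := exactly_one N in ih *.
have S0 : 0 <= S by apply: sumr_ge0 => i _; exact: powR_ge0.
move=> hy; apply: le_trans (ler_normD _ _) _.
rewrite normrM normrN !normrM (ger0_norm (_ : 0 <= P N))// normr_nat.
rewrite (ger0_norm (exprn_ge0 _ _))// (@ger0_norm _ (1 - _)) ?subr_ge0//.
apply: le_trans (lerD (lexx _) (ler_wpM2l _ ih)) _; first by rewrite subr_ge0.
have -> : P N * (k%:R * t N ^+ k.-1 * `|d N|) =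
    k%:R * a * (t N ^+ k.-1 * P N * (`|d N| / a)).
  by field; rewrite gt_eqF.
rewrite (mulrCA (1 - _)) -mulrDr ler_wpM2l ?mulr_ge0// ?(ltW a0)//.
apply: le_trans (lerD hy (lexx _)) _.
have : 0 <= t N ^+ k * (S / r) by rewrite mulr_ge0// divr_ge0//; lra.
rewrite !mulrDl; nra.
Qed.

(** Although all the [N] factors of [P N] may have large derivatives at the same
    point, the r-th power of the derivative of [P N] is bounded by the sum of the
    r-th powers of the [d i] with a factor independent of [N]: in Hölder's
    inequality the other sum is at most that of the
    [t i ^+ k * \prod_(j != i) (1 - t j ^+ k)], a probability. *)
Lemma prod_derive_powR_le N :
  `|prod_derive N| `^ r <= k%:R `^ r * \sum_(i < N) `|d i| `^ r.
Proof.
have k0 : 0 < k%:R :> R by rewrite ltr0n; case: k k1.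
have r0 : 0 < r := lt_trans ltr01 r1.
have [->|D0] := eqVneq (prod_derive N) 0.
  by rewrite normr0 powR0 ?gt_eqF// mulr_ge0 ?powR_ge0// sumr_ge0// => i _; exact: powR_ge0.
have nD : 0 < `|prod_derive N| by rewrite normr_gt0.
(* With this value of a, the bound of prod_derive_young has the same factor on
   both sides and leaves an inequality between the sum and 1. *)
set a := `|prod_derive N| / k%:R; have a0 : 0 < a by rewrite /a divr_gt0.
have Da : `|prod_derive N| = k%:R * a by rewrite /a mulrC divfK ?gt_eqF.
have := prod_derive_young N a0; rewrite -{1}[`|prod_derive N|]mulr1 Da ler_pM2l ?(mulr_gt0 k0 a0)//.
move=> h; have q1 := exactly_one_le1 N.
have {h} h : 1 <= \sum_(i < N) (`|d i| / a) `^ r.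
  have : exactly_one N / r' <= r'^-1 by rewrite ler_piMl// invr_ge0 (ltW r'0).
  move: h; rewrite -{1}conj_expE; set z := \sum_(i < N) _ => h h'.
  have : r^-1 <= z / r by lra.
  by rewrite ler_pdivlMr// mulVf// gt_eqF.
rewrite powRM ?(ltW k0) ?(ltW a0)// ler_pM2l ?powR_gt0//.
rewrite -[leLHS]mulr1; apply: le_trans (ler_wpM2l (powR_ge0 _ _) h) _.
rewrite mulr_sumr; apply: ler_sum => i _.
have da0 : 0 <= `|d i| / a by rewrite divr_ge0 ?normr_ge0 ?(ltW a0).
by rewrite -(powRM _ (ltW a0) da0) [a * _]mulrC divfK ?(gt_eqF a0).
Qed.

End ProductGradient.

(** * Cubes and their bump functions *)

Section Cubes.
Context {R : realType} {n : nat}.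
Implicit Types (c x : 'cV[R]_n).

Definition cube c (s : R) : set 'cV[R]_n := [set x | forall i, `|x i 0 - c i 0| <= s].

Lemma cubeE c s : cube c s = box (c - const_mx s, c + const_mx s).
Proof.
apply/seteqP; split=> x /= h i; have := h i; rewrite !mxE ler_norml => /andP[? ?].
  by apply/andP; split; lra.
by apply/andP; split; lra.
Qed.

Lemma lebesgue_outer_cube c s : 0 <= s ->
  (lebesgue_outer (cube c s) <= ((2 * s) ^+ n)%:E)%E.
Proof.
move=> s0; rewrite cubeE; apply: le_trans (lebesgue_outer_box _) _.
rewrite lee_fin /box_vol /= (eq_bigr (fun=> 2 * s)); last first.
  by move=> i _; rewrite !mxE max_r; lra.
by rewrite prodr_const card_ord.
Qed.

Lemma cube_closed c s : closed (cube c s).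
Proof.
have -> : cube c s = \bigcap_(i in [set: 'I_n])
    ((fun x : 'cV[R]_n => `|x i 0 - c i 0|) @^-1` [set y | y <= s]).
  by apply/seteqP; split=> x /= h i => [_|]; [exact: h|exact: (h i Logic.I)].
apply: closed_bigI => i _; apply: preimage_closed; last exact: closed_le.
move=> x _; apply: (@continuous_comp _ _ _ (fun x : 'cV[R]_n => x i 0 - c i 0) Num.norm).
  by apply: continuousB; [exact: coord_continuous|exact: cst_continuous].
exact: norm_continuous.
Qed.

Lemma cube_measurable c s : lmeasurable (cube c s).
Proof. by apply: closed_lebesgue_measurable; exact: cube_closed. Qed.

Lemma partial_prod0 I (r : seq I) (P : pred I) (F : I -> 'cV[R]_n -> R) l x :
  (forall i, smoothR (F i)) -> (forall i, P i -> partialR l (F i) x = 0) ->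
  partialR l (fun x => \prod_(i <- r | P i) F i x) x = 0.
Proof.
move=> sF F0; elim: r => [|i r ih].
  rewrite -[RHS](@partial_cst R n 1 l x); apply: eq_partial => y.
  by rewrite big_nil.
case Pi: (P i); last first.
  by rewrite -ih; apply: eq_partial => y; rewrite big_cons Pi.
have := partialM l x (sF i) (smooth_prod r P sF); rewrite ih F0// !mulr0 addr0 => <-.
by apply: eq_partial => y; rewrite big_cons Pi.
Qed.

Definition bump c (rho : R) : 'cV[R]_n -> R :=
  fun x => \prod_(j < n) plateau (rho^-1 * x j 0 + - (rho^-1 * c j 0)).

Let side (c : 'cV[R]_n) rho j : R -> R :=
  fun t => plateau (rho^-1 * t + - (rho^-1 * c j 0)).

Lemma elementary_side c rho j : elementary (side c rho j).
Proof. by apply: elementary_affine; exact: elementary_plateau. Qed.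

Lemma bump_smooth c rho : smoothR (bump c rho).
Proof.
by apply: smooth_prod => j; exact: (smooth_coord j (elementary_side c rho j)).
Qed.

Lemma bump01 c rho x : 0 <= bump c rho x <= 1.
Proof.
apply/andP; split.
    apply: prodr_ge0 => j _.
    by have /andP[] := plateau01 (rho^-1 * x j 0 + - (rho^-1 * c j 0)).
by apply: prodr_ile1 => j _; exact: plateau01.
Qed.

Let scaled (c x : 'cV[R]_n) rho j : 0 < rho ->
  `|rho^-1 * x j 0 + - (rho^-1 * c j 0)| = rho^-1 * `|x j 0 - c j 0|.
Proof.
by move=> r0; rewrite -mulrBr normrM ger0_norm// invr_ge0 ltW.
Qed.

Lemma bump1 c rho x : 0 < rho -> cube c rho x -> bump c rho x = 1.
Proof.
move=> r0 cx; apply: big1 => j _; apply: plateau1.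
by rewrite scaled// mulrC ler_pdivrMr// mul1r; exact: cx.
Qed.

Lemma bump0 c rho x : 0 < rho -> ~ cube c (2 * rho) x -> bump c rho x = 0.
Proof.
move=> r0 /existsNP[j /negP]; rewrite -ltNge => h.
rewrite /bump (bigD1 j)//= plateau0 ?mul0r//.
by rewrite scaled// mulrC ler_pdivlMr// ltW.
Qed.

(** The factor 1 / rho is what makes covers by small cubes of small total
    rho ^ (n - p) yield cutoff functions of small energy. *)
Lemma bump_partial : exists2 L : R, 0 < L & forall c rho l x, 0 < rho ->
  `|partialR l (bump c rho) x| <= L / rho * \1_(cube c (2 * rho)) x.
Proof.
have [theta' [L [eth dth L0 thL th0]]] := @plateau_derive R.
exists L => // c rho l x r0.
have ds (t : R) : is_derive t (1 : R) (side c rho l)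
    (theta' (rho^-1 * t + - (rho^-1 * c l 0)) * rho^-1).
  apply: (@is_derive1_comp _ plateau (fun t => rho^-1 * t + - (rho^-1 * c l 0))) => //.
  by apply: is_derive_eq; rewrite /GRing.scale/=; ring.
pose g x := \prod_(j < n | j != l) side c rho j (x j 0).
have sF (j : 'I_n) : smoothR (fun x : 'cV[R]_n => side c rho j (x j 0)).
  by apply: smooth_coord; exact: elementary_side.
have sg : smoothR g by exact: smooth_prod.
have pg : partialR l g x = 0.
  apply: partial_prod0 => // j jl.
  have [s' [_ ds']] := elementary_derive (elementary_side c rho j).
  have [_] := is_derive_coord l j x ds'.
  by rewrite eq_sym (negPf jl) mul0r.
have -> : partialR l (bump c rho) x =
    g x * (theta' (rho^-1 * x l 0 + - (rho^-1 * c l 0)) * rho^-1).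
  rewrite (@eq_partial _ _ _ (fun x => side c rho l (x l 0) * g x)); last first.
    by move=> y; rewrite /bump (bigD1 l).
  have := partialM l x (sF l) sg; rewrite pg mulr0 add0r => ->.
  congr (_ * _); have [_ h] := is_derive_coord l l x ds.
  by rewrite /partialR /partial h eqxx mul1r.
have [cx|cx] := pselect (cube c (2 * rho) x).
  rewrite indicE mem_set//= mulr1 normrM normrM (ger0_norm (_ : 0 <= rho^-1)); last first.
    by rewrite invr_ge0 ltW.
  have g01 : 0 <= g x <= 1.
    apply/andP; split.
    apply: prodr_ge0 => j _.
    by have /andP[] := plateau01 (rho^-1 * x j 0 + - (rho^-1 * c j 0)).
    by apply: prodr_ile1 => j _; exact: plateau01.
  have /andP[g0 g1] := g01.
  rewrite ger0_norm// mulrA ler_wpM2r ?invr_ge0 ?(ltW r0)//.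
  by apply: le_trans (thL (rho^-1 * x l 0 + - (rho^-1 * c l 0))); rewrite ler_piMl.
rewrite indicE memNset//= mulr0.
move/existsNP: cx => [j /negP]; rewrite -ltNge => h.
have [jl|jl] := eqVneq j l.
  rewrite th0 ?mul0r ?mulr0 ?normr0//.
  by rewrite scaled// mulrC ltr_pdivlMr// -jl.
rewrite /g (bigD1 j)//= /side plateau0 ?mul0r ?normr0//.
by rewrite scaled// mulrC ler_pdivlMr// ltW.
Qed.

End Cubes.

(** * Cutoff functions of a finite family of cubes *)

(** The integral of a nonnegative function is a supremum over the simple
    functions below it, which gives monotonicity for functions that need not be
    measurable, such as those built from the operator norm. *)
Lemma ge0_le_integralT d (T : measurableType d) (R : realType)
    (mu : {measure set T -> \bar R}) (f g : T -> \bar R) :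
  (forall x, 0 <= f x)%E -> (forall x, f x <= g x)%E ->
  (\int[mu]_x f x <= \int[mu]_x g x)%E.
Proof.
move=> f0 fg; have g0 x : (0 <= g x)%E by apply: le_trans (fg x).
rewrite !ge0_integralTE//; apply: ereal_sup_le => _ [h hf <-].
by exists h => // x; exact: le_trans (fg x).
Qed.

Section Cutoff.
Context {R : realType} {n : nat}.
Variables (k : nat) (c : nat -> 'cV[R]_n) (rho : nat -> R).
Hypotheses (k1 : (1 < k)%N) (rho0 : forall i, 0 < rho i).

(** The k-th powers make [prod_derive_powR_le] applicable. *)
Definition cutoff N (x : 'cV[R]_n) : R :=
  \prod_(i < N) (1 - bump (c i) (rho i) x ^+ k).

Lemma cutoff_smooth N : smoothR (cutoff N).
Proof.
by apply: smooth_prod => i; apply: smooth_1B; apply: smoothX; exact: bump_smooth.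
Qed.

Lemma cutoff01 N x : 0 <= cutoff N x <= 1.
Proof.
have b01 i : 0 <= bump (c i) (rho i) x ^+ k <= 1.
  by have /andP[? ?] := bump01 (c i) (rho i) x; rewrite exprn_ge0//= exprn_ile1.
apply/andP; split; first by apply: prodr_ge0 => i _; rewrite subr_ge0; have /andP[] := b01 i.
by apply: prodr_ile1 => i _; have /andP[a b] := b01 i; rewrite subr_ge0 gerBl a b.
Qed.

Lemma cutoff0 N i x : (i < N)%N -> cube (c i) (rho i) x -> cutoff N x = 0.
Proof.
move=> iN cx; rewrite /cutoff (bigD1 (Ordinal iN))//= bump1// expr1n subrr.
by rewrite mul0r.
Qed.

Lemma cutoff1 N x : (forall i, (i < N)%N -> ~ cube (c i) (2 * rho i) x) ->
  cutoff N x = 1.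
Proof.
move=> h; apply: big1 => i _; rewrite bump0//; last exact: h.
by rewrite expr0n; case: k k1 => // k' _; rewrite subr0.
Qed.

Lemma cutoff_partial N l x : partialR l (cutoff N) x =
  prod_derive k (fun i => bump (c i) (rho i) x)
    (fun i => partialR l (bump (c i) (rho i)) x) N.
Proof.
elim: N => /= [|N ih].
  rewrite -[RHS](@partial_cst R n 1 l x); apply: eq_partial => y.
  by rewrite /cutoff big_ord0.
have sb := bump_smooth (c N) (rho N).
have sb1 := smooth_1B (smoothX k sb).
have := partialM l x (cutoff_smooth N) sb1.
rewrite ih (partial_1B l x (smoothX k sb)) (partialX k l x sb) => <-; apply: eq_partial => y.
by rewrite /cutoff big_ord_recr.
Qed.

Lemma cutoff_partial_powR (L p : R) : 1 <= p <= k%:R ->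
  (forall c rho l x, 0 < rho -> `|partialR l (@bump R n c rho) x| <=
     L / rho * \1_(cube c (2 * rho)) x) ->
  forall N l x, `|partialR l (cutoff N) x| `^ p <=
    \sum_(i < N) (k%:R `^ p * (L / rho i) `^ p) * \1_(cube (c i) (2 * rho i)) x.
Proof.
move=> /andP[p1 pk] hL N l x.
have p0 : p != 0 by rewrite gt_eqF// (lt_le_trans ltr01 p1).
have L0 i : `|partialR l (bump (c i) (rho i)) x| `^ p <=
    (L / rho i) `^ p * \1_(cube (c i) (2 * rho i)) x.
  apply: le_trans (_ : (L / rho i * \1_(cube (c i) (2 * rho i)) x) `^ p <= _).
    by apply: ge0_ler_powR; rewrite ?nnegrE ?(le_trans ler01 p1)//;
      [apply: le_trans (hL _ _ l x (rho0 i))|exact: hL].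
  rewrite indicE; case: (_ \in _); first by rewrite !mulr1.
  by rewrite !mulr0 powR0.
apply: (@le_trans _ _ (k%:R `^ p * \sum_(i < N) `|partialR l (bump (c i) (rho i)) x| `^ p)).
  rewrite cutoff_partial.
  have t01 i : 0 <= bump (c i) (rho i) x <= 1 by exact: bump01.
  have [->|pn1] := eqVneq p 1.
    rewrite powRr1// powRr1//; under eq_bigr do rewrite powRr1//.
    exact: prod_derive_le.
  by apply: prod_derive_powR_le => //; rewrite lt_neqAle eq_sym pn1.
rewrite mulr_sumr; apply: ler_sum => i _; rewrite -mulrA ler_wpM2l ?powR_ge0//.
Qed.

Lemma integral_sum_cubes N (a : nat -> R) : (forall i, 0 <= a i) ->
  (\int[@lebesgue R n]_x
     (\sum_(i < N) a i * \1_(cube (c i) (2 * rho i)) x)%:E <=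
   (\sum_(i < N) a i * (4 * rho i) ^+ n)%:E)%E.
Proof.
move=> a0.
under eq_integral do rewrite -sumEFin.
have mc i : measurable (cube (c i) (2 * rho i) : set (lebesgue_space R n)).
  exact: cube_measurable.
have m1 i : measurable_fun setT
    ((fun x => (\1_(cube (c i) (2 * rho i)) x)%:E) : lebesgue_space R n -> \bar R).
  by apply/measurable_EFinP; apply: measurable_indic; exact: mc.
rewrite (@ge0_integral_sum _ (lebesgue_space R n) _ _ setT measurableT _
  (fun i : 'I_N => fun x => (a i * \1_(cube (c i) (2 * rho i)) x)%:E)); last 2 first.
- by move=> i; under eq_fun do rewrite EFinM; exact: measurable_funeM.
- by move=> i x _; rewrite lee_fin mulr_ge0.
rewrite -sumEFin; apply: lee_sum => i _.
under eq_integral do rewrite EFinM.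
rewrite ge0_integralZl_EFin//=.
rewrite integral_indic// setIT EFinM lee_wpmul2l ?lee_fin//.
have -> : 4 * rho i = 2 * (2 * rho i) by ring.
by apply: lebesgue_outer_cube; rewrite mulr_ge0 ?(ltW (rho0 i)).
Qed.

End Cutoff.

(** A bump of radius rho has a gradient of order 1 / rho on a set of measure of
    order rho ^ n, hence contributes rho ^ (n - p) <= rho ^ s to the energy. The
    constant is independent of the number of cubes and of their overlaps. *)
Lemma cutoff_energy (R : realType) (n k : nat) (p s : R) :
  (1 < k)%N -> 1 <= p <= k%:R -> s <= n%:R - p -> exists2 A : R, 0 < A &
  forall (c : nat -> 'cV[R]_n) (rho : nat -> R), (forall i, 0 < rho i <= 1) ->
  forall N l, (\int[@lebesgue R n]_x (`|partialR l (cutoff k c rho N) x| `^ p)%:E <=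
    (A * \sum_(i < N) rho i `^ s)%:E)%E.
Proof.
move=> k1 pk snp; have [L L0 hL] := @bump_partial R n.
exists (k%:R `^ p * L `^ p * 4 ^+ n).
  by rewrite !mulr_gt0 ?powR_gt0 ?exprn_gt0// ltr0n ltnW.
move=> c rho rho01 N l; have rho0 i : 0 < rho i by have /andP[] := rho01 i.
pose g (x : 'cV[R]_n) : R :=
  \sum_(i < N) (k%:R `^ p * (L / rho i) `^ p) * \1_(cube (c i) (2 * rho i)) x.
have h1 : (\int[@lebesgue R n]_x (`|partialR l (cutoff k c rho N) x| `^ p)%:E <=
    \int[@lebesgue R n]_x (g x)%:E)%E.
  apply: ge0_le_integralT => x; first by rewrite lee_fin powR_ge0.
  by rewrite lee_fin; exact: cutoff_partial_powR.
have h2 := @integral_sum_cubes _ n c rho rho0 N (fun i => k%:R `^ p * (L / rho i) `^ p)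
  (fun i => mulr_ge0 (powR_ge0 _ _) (powR_ge0 _ _)).
refine (le_trans h1 (le_trans h2 _)).
rewrite lee_fin mulr_sumr; apply: ler_sum => i _.
rewrite powRM ?invr_ge0 ?(ltW L0) ?(ltW (rho0 i))// exprMn.
rewrite (_ : _ * _ = k%:R `^ p * L `^ p * 4 ^+ n * ((rho i)^-1 `^ p * rho i ^+ n)); last by ring.
rewrite ler_wpM2l ?mulr_ge0 ?powR_ge0 ?exprn_ge0//.
rewrite -powR_mulrn ?(ltW (rho0 i))// -powR_inv1 ?(ltW (rho0 i))// -powRrM mulN1r.
rewrite -powRD; last by rewrite (gt_eqF (rho0 i)) implybT.
by rewrite addrC; apply: ger_powR; [exact: rho01|exact: snp].
Qed.

(** * Covers of sets of Hausdorff measure zero *)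

Section Covers.
Context {R : realType} {n : nat}.
Implicit Types (A T : set 'cV[R]_n).

Lemma coord_le_enorm (x : 'cV[R]_n) i : `|x i 0| <= enorm x.
Proof.
rewrite -sqrtr_sqr ler_wsqrtr// (bigD1 i)//= lerDl.
by apply: sumr_ge0 => j _; exact: sqr_ge0.
Qed.

Lemma ediam_coord A d (x y : 'cV[R]_n) : (ediam A <= d%:E)%E -> A x -> A y ->
  forall i, `|x i 0 - y i 0| <= d.
Proof.
move=> Ad Ax Ay i; rewrite -lee_fin; apply: le_trans Ad.
rewrite /ediam le_max; apply/orP; right.
apply: le_trans (_ : (enorm (x - y))%:E <= _)%E.
  by rewrite lee_fin; have := coord_le_enorm (x - y) i; rewrite !mxE.
by apply: ereal_sup_ubound; exists (x, y).
Qed.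

Lemma geometric_sum_le (e : R) N : 0 <= e -> \sum_(i < N) e / 2 ^+ i.+1 <= e.
Proof.
move=> e0; suff -> : \sum_(i < N) e / 2 ^+ i.+1 = e - e / 2 ^+ N.
  by rewrite gerBl divr_ge0// exprn_ge0.
elim: N => [|N ih]; first by rewrite big_ord0 expr0 divr1 subrr.
by rewrite big_ord_recr/= ih exprS; field; rewrite expf_neq0.
Qed.

(** The pieces of a cover by sets of small diameters are given radii that are
    positive and strictly larger than the diameters, also when these vanish. *)
Lemma hausdorff_null_cover A (s e d : R) :
  0 < s -> hausdorff s A = 0%E -> 0 < e -> 0 < d ->
  exists (U : nat -> set 'cV[R]_n) (r : nat -> R),
    [/\ A `<=` \bigcup_i U i,
        forall i, 0 < r i <= d,
        forall i x y, U i x -> U i y -> forall j, `|x j 0 - y j 0| < r i &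
        forall N, \sum_(i < N) r i `^ s <= e].
Proof.
move=> s0 A0 e0 d0.
set h := e / (2 `^ s + 1).
have h0 : 0 < h by rewrite divr_gt0// ltr_wpDl// powR_ge0.
have : (hausdorff_pre s (d / 2) A < h%:E)%E.
  apply: (@le_lt_trans _ _ 0%E); last by rewrite lte_fin.
  rewrite -A0; apply: ereal_sup_ubound; exists (d / 2) => //=.
  by rewrite divr_gt0.
move=> /ereal_inf_lt[_ [U [AU dU] <-] sU].
have ed0 i : (0 <= ediam (U i))%E by rewrite /ediam le_max lexx.
have fd i : ediam (U i) \is a fin_num.
  by rewrite ge0_fin_numE//; apply: le_lt_trans (dU i) _; rewrite ltry.
(* Twice the diameter is a suitable radius unless the diameter is 0; the q i,
   whose s-th powers are summable, are for that case. *)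
pose q i := Num.min d ((h / 2 ^+ i.+1) `^ s^-1).
have hi0 i : 0 < h / 2 ^+ i.+1 by rewrite divr_gt0// exprn_gt0.
have q0 i : 0 < q i by rewrite lt_min d0 powR_gt0.
pose r i := Num.max (2 * fine (ediam (U i))) (q i).
have fd0 i : 0 <= fine (ediam (U i)) by exact: fine_ge0.
exists U, r; split => //.
- move=> i; rewrite /r lt_max q0 orbT/= ge_max ge_min lexx/= andbT.
  by have := dU i; rewrite -[ediam _]fineK// lee_fin; lra.
- move=> i x y Ux Uy j.
  apply: le_lt_trans (ediam_coord (d := fine (ediam (U i))) _ Ux Uy j) _.
    by rewrite fineK.
  rewrite /r lt_max; have := fd0 i; rewrite le_eqVlt => /predU1P[<-|f0].
    by rewrite q0 orbT.
  by apply/orP; left; lra.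
- move=> N.
  apply: (@le_trans _ _ (\sum_(i < N) (2 `^ s * fine (ediam (U i)) `^ s + h / 2 ^+ i.+1))).
    apply: ler_sum => i _; rewrite /r -powRM//.
    have p0 (x : R) : 0 <= x `^ s by exact: powR_ge0.
    have qs : q i `^ s <= h / 2 ^+ i.+1.
      apply: le_trans (_ : ((h / 2 ^+ i.+1) `^ s^-1) `^ s <= _).
        by apply: ge0_ler_powR; rewrite ?nnegrE ?powR_ge0 ?(ltW s0) ?(ltW (q0 i))// ge_min lexx orbT.
      by rewrite -powRrM mulVf ?(gt_eqF s0)// powRr1// (ltW (hi0 i)).
    case: (leP (q i) (2 * fine (ediam (U i)))) => _.
      by rewrite lerDl ltW.
    by apply: le_trans qs _; rewrite lerDr.
  rewrite big_split/= -mulr_sumr.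
  have : \sum_(i < N) fine (ediam (U i)) `^ s <= h.
    rewrite -lee_fin -sumEFin; apply: le_trans (ltW sU).
    rewrite -(big_mkord xpredT (fun i => (fine (ediam (U i)) `^ s)%:E)).
    under eq_bigr do rewrite -poweR_EFin fineK//.
    by apply: nneseries_lim_ge => i _ _; exact: poweR_ge0.
  have hN := geometric_sum_le N (ltW h0).
  move=> hU; apply: le_trans (lerD (ler_wpM2l (powR_ge0 2 s) hU) hN) _.
  rewrite -[X in _ + X]mul1r -mulrDl /h mulrC divfK// gt_eqF//.
Qed.

Lemma hausdorff_null_lebesgue_null A (s : R) : 0 < s -> s <= n%:R ->
  hausdorff s A = 0%E -> lebesgue_outer A = 0%E.
Proof.
move=> s0 sn A0; apply/eqP; rewrite eq_le lebesgue_outer_ge0 andbT.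
apply/lee_addgt0Pr => e e0; rewrite add0e.
have e'0 : 0 < e / 2 ^+ n by rewrite divr_gt0// exprn_gt0.
have [U [r [AU r01 Ur sr]]] := hausdorff_null_cover s0 A0 e'0 ltr01.
apply: le_trans (le_lebesgue_outer AU) _.
apply: le_trans (lebesgue_outer_sigma_subadditive _) _.
have Ui i : (lebesgue_outer (U i) <= (2 ^+ n * r i `^ s)%:E)%E.
  have /andP[r0 r1] := r01 i.
  have [->|/set0P[x Ux]] := eqVneq (U i) set0.
    by rewrite lebesgue_outer0 lee_fin mulr_ge0 ?exprn_ge0 ?powR_ge0.
  apply: le_trans (_ : lebesgue_outer (cube x (r i)) <= _)%E.
    by apply: le_lebesgue_outer => y Uy j; apply: ltW; exact: Ur.
  apply: le_trans (lebesgue_outer_cube _ (ltW r0)) _.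
  rewrite lee_fin exprMn ler_wpM2l ?exprn_ge0// -powR_mulrn ?(ltW r0)//.
  by apply: ger_powR; rewrite ?r0.
apply: lime_le; first by apply: is_cvg_nneseries => *; exact: lebesgue_outer_ge0.
apply: nearW => N; rewrite big_mkord.
apply: (@le_trans _ _ (\sum_(i < N) (2 ^+ n * r i `^ s)%:E)%E).
  by apply: lee_sum => i _; exact: Ui.
rewrite sumEFin lee_fin -mulr_sumr mulrC -ler_pdivlMr ?exprn_gt0//.
Qed.

Lemma hausdorff_null_finite_cover A T (s e d : R) :
  0 < s -> hausdorff s A = 0%E -> 0 < e -> 0 < d -> compact T -> T `<=` A ->
  exists N (c : nat -> 'cV[R]_n) (r : nat -> R),
    [/\ forall i, 0 < r i <= d,
        forall i, (i < N)%N -> T (c i),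
        \sum_(i < N) r i `^ s <= e &
        exists O : set 'cV[R]_n, [/\ open O, T `<=` O &
          forall x, O x -> exists2 i, (i < N)%N & cube (c i) (r i) x]].
Proof.
move=> s0 A0 e0 d0 cT TA.
have [T0|/set0P[t0 Tt0]] := eqVneq T set0.
  exists 0%N, (fun=> 0), (fun=> d); split=> //; first by move=> i; rewrite d0 lexx.
    by rewrite big_ord0 ltW.
  by exists set0; split; [exact: open0|rewrite T0|].
have [U [r [AU r01 Ur sr]]] := hausdorff_null_cover s0 A0 e0 d0.
have /choice[c cP] : forall i, exists c, T c /\ (U i `&` T !=set0 -> U i c).
  move=> i; have [[x [Ux Tx]]|h] := pselect (U i `&` T !=set0); first by exists x.
  by exists t0.
have Tc : T `<=` cover [set: nat] (fun i => ball (c i) (r i)).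
  move=> x Tx; have [i _ Ux] := AU _ (TA _ Tx); exists i => //.
  have /andP[r0 _] := r01 i; split=> // j k; rewrite (ord1 k).
  by apply: (Ur i) => //; apply: (cP i).2; exists x.
have oB i : [set: nat] i -> open (ball (c i) (r i)).
  by move=> _; apply: ball_open; have /andP[] := r01 i.
have /(_ nat setT _ oB Tc)[D' _ TD] : cover_compact T by rewrite -compact_cover.
have [D DE] : exists D : seq nat, T `<=` cover [set` D] (fun i => ball (c i) (r i)).
  by have := finite_fset D'; rewrite finite_seqP => -[D DE]; exists D; rewrite -DE.
exists (\max_(i <- D) i).+1, c, r; split=> //; first by move=> i _; exact: (cP i).1.
exists (\bigcup_(i in [set` D]) ball (c i) (r i)); split => //.
  by apply: bigcup_open => i _; apply: ball_open; have /andP[] := r01 i.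
move=> x [i /= iD [_ cx]]; exists i; first by rewrite ltnS; exact: leq_bigmax_seq.
by move=> j; have := cx j 0; rewrite /ball/= distrC => /ltW.
Qed.

End Covers.

(** * Test functions and cutoffs of null sets *)

Section TestFunctions.
Context {R : realType} {n : nat}.
Implicit Types (V W T S : set 'cV[R]_n) (phi : 'cV[R]_n -> R).

Definition supp phi : set 'cV[R]_n := closure [set x | phi x != 0].

Lemma supp0 phi x : ~ supp phi x -> phi x = 0.
Proof.
by move=> h; apply/eqP/negPn/negP => /eqP/eqP p0; apply: h; exact: subset_closure.
Qed.

Lemma partial_supp0 phi l x : ~ supp phi x -> partialR l phi x = 0.
Proof.
move=> h; rewrite -[RHS](@partial_cst R n 0 l x); apply: near_eq_derive.
have : nbhs x (~` supp phi).
  by apply: open_nbhs_nbhs; split=> //; apply: closed_openC; exact: closed_closure.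
by apply: filterS => y; exact: supp0.
Qed.

Lemma cube_compact (c : 'cV[R]_n) (s : R) : compact (cube c s).
Proof.
pose I (i : 'I_n) : set R := `[c i 0 - s, c i 0 + s]%classic.
pose Q := [set v : 'rV[R]_n | forall i, I i (v ord0 i)].
have cQ : compact Q.
  by apply: (@rV_compact R n I) => i; exact: segment_compact.
have ct : continuous (@trmx R 1 n).
  move=> x A /nbhs_ballP[e /= e0 eA]; apply/nbhs_ballP; exists e => //= y [_ xy].
  by apply: eA; split=> // i j; rewrite !mxE; exact: xy.
have -> : cube c s = [set v^T | v in Q].
  apply/seteqP; split=> [x cx|_ [v vQ <-] i]; last first.
    by have := vQ i; rewrite /I /= in_itv/= mxE ler_norml => /andP[? ?]; apply/andP; split; lra.
  exists x^T; last by rewrite trmxK.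
  move=> i; rewrite /I /= in_itv/= mxE; have := cx i; rewrite ler_norml => /andP[? ?].
  by apply/andP; split; lra.
by apply: continuous_compact => //; exact: continuous_subspaceT.
Qed.

Lemma compact_subcube S : compact S -> exists2 s : R, 0 <= s & S `<=` cube 0 s.
Proof.
move=> /compact_bounded[M [_ hM]]; exists (`|M| + 1); first by rewrite addr_ge0.
move=> x Sx i; rewrite mxE subr0.
apply: le_trans (hM (`|M| + 1) _ x Sx); last first.
  by rewrite ltr_pwDr// ler_norm.
rewrite (_ : `|x| = mx_norm x)// mx_normrE.
exact: (@le_bigmax _ _ _ _ (fun i : 'I_n * 'I_1 => `|x i.1 i.2|) (i, 0)).
Qed.

Lemma hausdorff_cV : hausdorff_space 'cV[R]_n.
Proof. exact: norm_hausdorff. Qed.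

Lemma compact_lmeasurable S : compact S -> lmeasurable S.
Proof.
by move=> cS; apply: closed_lebesgue_measurable; apply: compact_closed => //; exact: hausdorff_cV.
Qed.

Lemma compact_lebesgue_lty S : compact S -> (@lebesgue R n S < +oo)%E.
Proof.
move=> /compact_subcube[s s0 Ss]; apply: le_lt_trans (le_lebesgue_outer Ss) _.
by apply: le_lt_trans (lebesgue_outer_cube _ s0) _; rewrite ltry.
Qed.

Lemma continuous_bounded_on S phi : compact S -> continuous phi ->
  (forall x, ~ S x -> phi x = 0) ->
  exists2 A : R, 0 < A & forall x, `|phi x| <= A * \1_S x.
Proof.
move=> cS cphi phi0; have [S0|S0] := eqVneq S set0.
  exists 1 => // x; rewrite phi0 ?normr0 ?mul1r// S0//.
have cn : {within S, continuous (fun x => `|phi x|)}.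
  apply: continuous_subspaceT => x; apply: (@continuous_comp _ _ _ phi Num.norm).
    exact: cphi.
  exact: norm_continuous.
move/set0P in S0; have [c cSc hc] := compact_EVT_max S0 cS cn.
exists (`|phi c| + 1) => [|x]; first by rewrite ltr_wpDl.
have [Sx|Sx] := pselect (S x).
  by rewrite indicE mem_set// mulr1 (le_trans (hc _ (mem_set Sx)))// lerDl.
by rewrite phi0// normr0 indicE memNset// mulr0.
Qed.

Lemma test_functionP W phi : smoothR phi -> compact (supp phi) ->
  supp phi `<=` W -> test_function W phi.
Proof. by move=> *; split. Qed.

(** One minus the cutoff function of a finite cover of [S] by cubes whose
    doubles lie in [V]. *)
Lemma compact_plateau V S : open V -> compact S -> S `<=` V ->
  exists2 phi : 'cV[R]_n -> R, test_function V phi &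
    (forall x, 0 <= phi x <= 1) /\ forall x, S x -> phi x = 1.
Proof.
move=> oV cS SV.
have /choice[r rP] : forall x : 'cV[R]_n, exists r : R,
    0 < r /\ (V x -> cube x (2 * r) `<=` V).
  move=> x; have [Vx|Vx] := pselect (V x); last by exists 1.
  have /nbhs_ballP[e /= e0 eV] : nbhs x V by exact: open_nbhs_nbhs.
  exists (e / 4); split=> [|_ y xy]; first by rewrite divr_gt0.
  apply: eV; split=> // i j; rewrite (ord1 j) /ball/= distrC.
  by apply: le_lt_trans (xy i) _; lra.
have oB i : S i -> open (ball i (r i)) by move=> _; apply: ball_open; exact: (rP i).1.
have SB : S `<=` cover S (fun i => ball i (r i)).
  by move=> x Sx; exists x => //; apply: ballxx; exact: (rP x).1.
have /(_ _ _ _ oB SB)[D DS] : cover_compact S by rewrite -compact_cover.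
have := finite_fset D; rewrite finite_seqP => -[s Ds]; rewrite Ds => SD.
have sS y : y \in s -> S y.
  move=> ys; have Dy : [set` s] y by [].
  by rewrite -Ds in Dy; exact/set_mem/DS.
pose c i := nth 0 s i; pose rho i := r (c i); pose N := size s.
have rho0 i : 0 < rho i by exact: (rP (c i)).1.
pose phi x := 1 - cutoff 2 c rho N x.
pose K := \big[setU/set0]_(i < N) cube (c i) (2 * rho i).
have cK : compact K by apply: bigsetU_compact => i _; exact: cube_compact.
have phiK : supp phi `<=` K.
  have cdK : closed K by apply: compact_closed => //; exact: hausdorff_cV.
  rewrite (closure_id K).1//; apply: closure_subset => x /= phix.
  apply: contrapT => Kx; move/eqP: phix; apply.
  rewrite /phi (@cutoff1 _ _ 2 c rho)// ?subrr// => i iN cx; apply: Kx.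
  by rewrite /K -(bigcup_mkord N (fun i => cube (c i) (2 * rho i))); exists i.
have cV i : (i < N)%N -> V (c i).
  by move=> iN; apply/SV/sS/mem_nth.
exists phi; last split.
- apply: test_functionP.
  + by apply: smooth_1B; exact: cutoff_smooth.
  + by apply: subclosed_compact cK phiK; exact: closed_closure.
  + move=> x /phiK; rewrite /K -(bigcup_mkord N (fun i => cube (c i) (2 * rho i))) => -[i /= iN].
    by apply: (rP (c i)).2; exact: cV.
- move=> x; have /andP[a b] := cutoff01 2 c rho N x.
  by rewrite /phi subr_ge0 b gerBl a.
- move=> x /SD[y /= yD [_ yx]]; rewrite /phi.
  rewrite (@cutoff0 _ _ 2 c rho rho0 N (index y s)) ?subr0 ?index_mem//.
  move=> j; rewrite /rho /c nth_index//; have := yx j 0.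
  by rewrite /ball/= distrC => /ltW.
Qed.

(** A compact part of a set of vanishing s-dimensional measure has zero
    r-capacity when [s <= n - r]: it can be cut off at an arbitrarily small cost
    in energy, by the cutoff function of a cover by small cubes. *)
Lemma null_cutoff (k : nat) (s r : R) (A T : set 'cV[R]_n) :
  (1 < k)%N -> 1 < r <= k%:R -> 0 < s <= n%:R - r -> hausdorff s A = 0%E ->
  compact T -> T `<=` A -> forall e : R, 0 < e ->
  exists chi : 'cV[R]_n -> R,
    [/\ smoothR chi, forall x, 0 <= chi x <= 1,
      exists O : set 'cV[R]_n, [/\ open O, T `<=` O & forall x, O x -> chi x = 0],
      forall x, (forall y, T y -> ~ cube y (2 * e) x) -> chi x = 1 &
      forall l, (\int[@lebesgue R n]_x (`|partialR l chi x| `^ r)%:E <= e%:E)%E /\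
                (\int[@lebesgue R n]_x (`|partialR l chi x|)%:E <= e%:E)%E].
Proof.
move=> k1 /andP[r1 rk] /andP[s0 sn] A0 cT TA e e0.
have hk1 : 1 <= (1 : R) <= k%:R by rewrite lexx/= ler1n ltnW.
have hkr : 1 <= r <= k%:R by rewrite ltW.
have s1 : s <= n%:R - 1 by lra.
have [B B0 hB] := @cutoff_energy R n k 1 s k1 hk1 s1.
have [C C0 hC] := @cutoff_energy R n k r s k1 hkr sn.
have d0 : 0 < Num.min 1 e by rewrite lt_min ltr01.
have eBC : 0 < e / (B + C) by rewrite divr_gt0// addr_gt0.
have [N [c [rho [rho01 cTN srho [U [oU TU hU]]]]]] :=
  hausdorff_null_finite_cover s0 A0 eBC d0 cT TA.
have rho0 i : 0 < rho i by have /andP[] := rho01 i.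
have rho1 i : 0 < rho i <= 1.
  by rewrite rho0/=; have /andP[_] := rho01 i; rewrite le_min => /andP[].
have rhoe i : rho i <= e.
  by have /andP[_] := rho01 i; rewrite le_min => /andP[].
have S0 : 0 <= \sum_(i < N) rho i `^ s by apply: sumr_ge0 => i _; exact: powR_ge0.
have BCe : (B + C) * \sum_(i < N) rho i `^ s <= e.
  by rewrite mulrC -ler_pdivlMr// addr_gt0.
exists (cutoff k c rho N); split.
- exact: cutoff_smooth.
- exact: cutoff01.
- exists U; split => // x /hU[i iN cx]; exact: cutoff0 cx.
- move=> x hx; apply: cutoff1 => // i iN cx; apply: (hx (c i)); first exact: cTN.
  by move=> j; apply: le_trans (cx j) _; rewrite ler_pM2l.
- move=> l; split.
    apply: le_trans (hC c rho rho1 N l) _; rewrite lee_fin.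
    by apply: le_trans BCe; rewrite ler_wpM2r// lerDr ltW.
  under eq_integral do rewrite -[X in X%:E]powRr1//.
  apply: le_trans (hB c rho rho1 N l) _; rewrite lee_fin.
  by apply: le_trans BCe; rewrite ler_wpM2r// lerDl ltW.
Qed.

End TestFunctions.

(** * The operator norm and Lebesgue norms of matrix fields *)

Section Norms.
Context {R : realType}.

Lemma powR_sum_le (I : finType) (r : R) (a : I -> R) : 0 < r ->
  (forall i, 0 <= a i) ->
  (\sum_i a i) `^ r <= #|I|%:R `^ r * \sum_i a i `^ r.
Proof.
move=> r0 a0; set T := \sum_i a i `^ r.
have T0 : 0 <= T by apply: sumr_ge0 => i _; exact: powR_ge0.
have rV (x : R) : 0 <= x -> (x `^ r^-1) `^ r = x.
  by move=> x0; rewrite -powRrM mulVf ?(gt_eqF r0)// powRr1.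
have aT i : a i <= T `^ r^-1.
  have -> : a i = (a i `^ r) `^ r^-1.
    by rewrite -powRrM mulfV ?(gt_eqF r0)// powRr1.
  apply: ge0_ler_powR; rewrite ?nnegrE ?powR_ge0 ?invr_ge0 ?(ltW r0)//.
  by rewrite /T (bigD1 i)//= lerDl; apply: sumr_ge0 => j _; exact: powR_ge0.
apply: le_trans (_ : (#|I|%:R * T `^ r^-1) `^ r <= _).
  apply: ge0_ler_powR; rewrite ?nnegrE ?(ltW r0) ?sumr_ge0 ?mulr_ge0 ?powR_ge0//.
  apply: le_trans (ler_sum _ (fun i _ => aT i)) _.
  by rewrite sumr_const mulr_natl.
by rewrite powRM ?powR_ge0// rV.
Qed.

Lemma enorm_le_sum n (x : 'cV[R]_n) : enorm x <= \sum_i `|x i 0|.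
Proof.
have S0 : 0 <= \sum_i `|x i 0| by exact: sumr_ge0.
rewrite /enorm -[leRHS]ger0_norm// -sqrtr_sqr ler_wsqrtr// expr2 mulr_suml.
apply: ler_sum => i _; rewrite -real_normK ?num_real// expr2 ler_wpM2l//.
by rewrite (bigD1 i)//= lerDl sumr_ge0.
Qed.

Section OpNorm.
Context {m n : nat}.
Implicit Type A : 'M[R]_(m, n).

Let values A := [set enorm (A *m x) | x in [set x : 'cV[R]_n | enorm x < 1]].

Let values_ub A : ubound (values A) (\sum_i \sum_j `|A i j|).
Proof.
move=> _ [x /= x1 <-]; apply: le_trans (enorm_le_sum _) _.
apply: ler_sum => i _; rewrite mxE; apply: le_trans (ler_norm_sum _ _ _) _.
apply: ler_sum => j _; rewrite normrM ler_piMr//.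
by apply: le_trans (coord_le_enorm _ _) (ltW x1).
Qed.

Let values0 A : values A 0.
Proof.
have e0 p : enorm (0 : 'cV[R]_p) = 0.
  by rewrite /enorm big1 ?sqrtr0// => i _; rewrite mxE expr0n.
by exists 0; rewrite ?mulmx0 /= e0.
Qed.

Lemma opnorm_le_sum A : opnorm A <= \sum_i \sum_j `|A i j|.
Proof. by apply: ge_sup; [exists 0; exact: values0|exact: values_ub]. Qed.

Lemma opnorm_ge0 A : 0 <= opnorm A.
Proof.
apply: ub_le_sup; last exact: values0.
by exists (\sum_i \sum_j `|A i j|); exact: values_ub.
Qed.

Lemma entry_le_opnorm A i j : `|A i j| <= opnorm A.
Proof.
rewrite leNgt; apply/negP => h; have S0 := opnorm_ge0 A.
have a0 : 0 < `|A i j| by exact: le_lt_trans S0 h.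
(* The supremum in opnorm is over vectors of norm < 1: test it on a multiple t
   of the j-th basis vector with t < 1 but t * |A i j| > opnorm A. *)
pose t := (opnorm A / `|A i j| + 1) / 2.
have Sa : opnorm A / `|A i j| < 1 by rewrite ltr_pdivrMr// mul1r.
have Sa0 : 0 <= opnorm A / `|A i j| by rewrite divr_ge0 ?(ltW a0).
have t0 : 0 <= t by rewrite /t; lra.
have t1 : t < 1 by rewrite /t; lra.
have tx : enorm (t *: delta_mx j 0 : 'cV[R]_n) < 1.
  apply: le_lt_trans (enorm_le_sum _) _.
  rewrite (bigD1 j)//= big1 ?addr0; last first.
    by move=> l lj; rewrite !mxE (negPf lj) mulr0 normr0.
  by rewrite !mxE !eqxx mulr1 ger0_norm.
have : `|A i j| * t <= opnorm A.
  apply: le_trans (_ : enorm (A *m (t *: delta_mx j 0)) <= _).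
    apply: le_trans (coord_le_enorm _ i).
    rewrite -scalemxAr mxE -colE mxE normrM (ger0_norm t0) mulrC.
    exact: lexx.
  apply: ub_le_sup; last by exists (t *: delta_mx j 0).
  by exists (\sum_i \sum_j `|A i j|); exact: values_ub.
rewrite leNgt => /negP; apply.
have -> : `|A i j| * t = (opnorm A + `|A i j|) / 2.
  by rewrite /t; field; rewrite gt_eqF.
lra.
Qed.

End OpNorm.

Section LnormMx.
Context {m n : nat}.
Implicit Types (W : set 'cV[R]_n) (f : 'cV[R]_n -> 'M[R]_(m, n)).

Let energy (r : R) W f : \bar R :=
  (\int[@lebesgue R n]_x
     (`|((fun x => (opnorm (f x))%:E) \_ W) x| `^ r))%E.

Let Lnorm_mxE r W f : Lnorm_mx r W f = (energy r W f `^ r^-1)%E.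
Proof. by rewrite /Lnorm_mx unlock. Qed.

Lemma Lnorm_mx_le (r B : R) W f (g : 'cV[R]_n -> R) : 0 < r -> 0 <= B ->
  (forall x, W x -> opnorm (f x) <= g x) ->
  (\int[@lebesgue R n]_(x in W) (g x `^ r)%:E <= B%:E)%E ->
  (Lnorm_mx r W f <= (B `^ r^-1)%:E)%E.
Proof.
move=> r0 B0 fg gB; rewrite Lnorm_mxE -poweR_EFin.
have h : (energy r W f <= B%:E)%E.
  apply: le_trans gB; rewrite [leRHS]integral_mkcond.
  apply: ge0_le_integralT => x; first exact: poweR_ge0.
  rewrite /patch; case: ifPn => [/set_mem Wx|_]; last by rewrite abse0 poweR0r ?gt_eqF.
  rewrite abse_EFin poweR_EFin lee_fin ger0_norm ?opnorm_ge0//.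
  by apply: ge0_ler_powR; rewrite ?nnegrE ?(ltW r0) ?opnorm_ge0 ?(le_trans (opnorm_ge0 _) (fg _ Wx))//; exact: fg.
apply: gt0_ler_poweR; rewrite ?invr_ge0 ?(ltW r0)// in_itv/= ?leey ?andbT//.
by apply: integral_ge0 => x _; exact: poweR_ge0.
Qed.

Lemma le_Lnorm_mx (r B : R) W f i j : 0 < r -> 0 <= B ->
  (Lnorm_mx r W f <= B%:E)%E ->
  (\int[@lebesgue R n]_(x in W) (`|f x i j| `^ r)%:E <= (B `^ r)%:E)%E.
Proof.
move=> r0 B0; rewrite Lnorm_mxE => h.
have e0 : (0 <= energy r W f)%E by apply: integral_ge0 => x _; exact: poweR_ge0.
have : (energy r W f <= (B `^ r)%:E)%E.
  rewrite -[leLHS]poweRe1// -(mulVf (lt0r_neq0 r0)) poweRrM -poweR_EFin.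
  by apply: gt0_ler_poweR; rewrite ?(ltW r0)// in_itv/= ?poweR_ge0 ?lee_fin ?leey ?andbT.
apply: le_trans; rewrite integral_mkcond.
apply: ge0_le_integralT => x; rewrite /patch; case: ifPn => // _; rewrite ?lee_fin ?powR_ge0//.
  rewrite ger0_norm ?opnorm_ge0//.
  by apply: ge0_ler_powR; rewrite ?nnegrE ?(ltW r0) ?opnorm_ge0//; exact: entry_le_opnorm.
Qed.

End LnormMx.

End Norms.

(** * Integrability *)

Section Integrability.
Context {R : realType} {n : nat}.
Implicit Types (V W S D : set 'cV[R]_n) (f g : 'cV[R]_n -> R).
Local Notation lmeasurable_fun D f :=
  (measurable_fun (D : set (lebesgue_space R n)) (f : lebesgue_space R n -> R)).

Lemma limn_einf_le (u : nat -> \bar R) (b : \bar R) :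
  (forall l, u l <= b)%E -> (limn_einf u <= b)%E.
Proof.
move=> ub; rewrite limn_einf_lim; apply: lime_le; first exact: is_cvg_einfs.
apply: nearW => l; apply: le_trans (ub l); apply: ereal_inf_lbound.
by exists l => /=.
Qed.

Lemma continuous_lmeasurable_fun D f : continuous f -> lmeasurable_fun D f.
Proof.
move=> cf; apply: (@measurable_funS _ _ _ _ setT) => //.
exact: continuous_lebesgue_measurable.
Qed.

Lemma null_lmeasurable_fun D f : lebesgue_outer D = 0%E -> lmeasurable_fun D f.
Proof.
move=> D0 _ Y _; apply: null_lebesgue_measurable; apply/eqP.
by rewrite eq_le lebesgue_outer_ge0 andbT -D0 le_lebesgue_outer.
Qed.

Lemma powR_norm_lmeasurable_fun D f (r : R) :
  lmeasurable_fun D f -> lmeasurable_fun D (fun x => `|f x| `^ r).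
Proof.
move=> mf.
exact (measurableT_comp (measurable_powR r) (measurableT_comp (@normr_measurable R setT) mf)).
Qed.

Lemma ge0_le_integral_subset (A B : set 'cV[R]_n) f : lmeasurable A -> lmeasurable B ->
  A `<=` B -> lmeasurable_fun B f -> (forall x, 0 <= f x) ->
  (\int[@lebesgue R n]_(x in A) (f x)%:E <= \int[@lebesgue R n]_(x in B) (f x)%:E)%E.
Proof.
move=> mA mB AB mf f0.
have mfE : measurable_fun (B : set (lebesgue_space R n)) (fun x => (f x)%:E).
  exact/measurable_EFinP.
have f0E (x : lebesgue_space R n) : B x -> (0 <= (f x)%:E)%E by rewrite lee_fin.
exact (ge0_subset_integral (@lebesgue R n) mA mB mfE f0E AB).
Qed.

Lemma norm_le_1powR (x r : R) : 1 <= r -> `|x| <= 1 + `|x| `^ r.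
Proof.
move=> r1; have [x1|x1] := leP `|x| 1.
  by apply: le_trans x1 _; rewrite lerDl powR_ge0.
by apply: le_trans (le1r_powR (ltW x1) r1) _; rewrite lerDr.
Qed.

Lemma Lp_loc_integrable (r A : R) V S f g : 1 <= r -> lmeasurable V ->
  Lp_loc r V f -> compact S -> S `<=` V -> continuous g ->
  (forall x, `|g x| <= A * \1_S x) ->
  (@lebesgue R n).-integrable V (fun x => (f x * g x)%:E).
Proof.
move=> r1 mV [mf fS] cS SV cg gA.
have mS := compact_lmeasurable cS.
have mg : lmeasurable_fun V g by exact: continuous_lmeasurable_fun.
have mfr := powR_norm_lmeasurable_fun r mf.
have m1 : lmeasurable_fun V (\1_S : 'cV[R]_n -> R) by exact: measurable_indic.
apply/integrableP; split; first by apply/measurable_EFinP; exact (measurable_funM mf mg).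
apply: (@le_lt_trans _ _ (\int[@lebesgue R n]_(x in S) (`|A| * (1 + `|f x| `^ r))%:E)%E).
  have SVS : V `&` S = S by apply/seteqP; split=> [x []//|x Sx]; split=> //; exact: SV.
  rewrite -[in leRHS]SVS integral_mkcondr.
  apply: (@ge0_le_integral _ (lebesgue_space R n) R (@lebesgue R n) V mV).
  - by move=> x _; exact: abse_ge0.
  - apply/measurable_EFinP.
    exact (measurableT_comp (@normr_measurable R setT) (measurable_funM mf mg)).
  - rewrite (_ : _ \_ _ = fun x => ((`|A| * (1 + `|f x| `^ r)) * \1_S x)%:E).
      apply/measurable_EFinP.
      exact (measurable_funM (measurable_funM (measurable_cst _)
        (measurable_funD (measurable_cst _) mfr)) m1).
    apply/funext => x; rewrite /patch indicE; case: ifPn => [/set_mem Sx|_].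
      by rewrite mulr1.
    by rewrite mulr0.
  move=> x _; rewrite /patch abse_EFin; have := gA x; rewrite indicE.
  case: ifPn => [_|_]; rewrite /= ?mulr1 ?mulr0 => gx; rewrite lee_fin normrM mulrC.
    apply: ler_pM => //; first exact: le_trans gx (ler_norm _).
    exact: norm_le_1powR.
  by apply: le_trans (ler_wpM2r _ gx) _; rewrite ?mul0r.
have mSf := measurable_funS mV SV mfr.
under eq_integral do rewrite EFinM.
have mSfE : measurable_fun (S : set (lebesgue_space R n)) (fun x => (`|f x| `^ r)%:E).
  exact/measurable_EFinP.
have mSf1 : measurable_fun (S : set (lebesgue_space R n)) (fun x => (1 + `|f x| `^ r)%:E).
  by apply/measurable_EFinP; exact (measurable_funD (measurable_cst _) mSf).
have f0 (x : lebesgue_space R n) : S x -> (0 <= (`|f x| `^ r)%:E)%E.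
  by move=> _; rewrite lee_fin powR_ge0.
have f10 (x : lebesgue_space R n) : S x -> (0 <= (1 + `|f x| `^ r)%:E)%E.
  by move=> _; rewrite lee_fin addr_ge0// powR_ge0.
rewrite (ge0_integralZl_EFin (@lebesgue R n) mS f10 mSf1 (normr_ge0 A)).
apply: lte_mul_pinfty => //.
under eq_integral do rewrite EFinD.
rewrite (ge0_integralD (@lebesgue R n) mS (fun x _ => lee01) (measurable_cst _) f0 mSfE).
apply: lte_add_pinfty; last exact: fS.
by rewrite integral_cst// mul1e; exact: compact_lebesgue_lty.
Qed.

End Integrability.

(** * Removable sets for bounded mappings with a Caccioppoli inequality *)

Lemma ae_mono d (T : measurableType d) (R : realType)
    (mu : {measure set T -> \bar R}) (P Q : T -> Prop) :
  {ae mu, forall x, P x} -> (forall x, P x -> Q x) -> {ae mu, forall x, Q x}.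
Proof. by move=> aeP PQ; apply: filterS aeP. Qed.

Section Removability.
Context {R : realType} {m n : nat}.
Variables (V C E : set 'cV[R]_n).
Hypotheses (V_open : open V) (C_closed : closed C) (E_def : E = V `&` C).
Variables (k : nat) (r s : R).
Hypotheses (k1 : (1 < k)%N) (r1k : 1 < r <= k%:R) (s0n : 0 < s <= n%:R - r).
Hypothesis E_null : hausdorff s E = 0%E.
Local Notation W := (V `\` E).
Local Notation mu := (@lebesgue R n).
Local Notation lmeasurable_fun D f :=
  (measurable_fun (D : set (lebesgue_space R n)) (f : lebesgue_space R n -> R)).

Let r1 : 1 < r. Proof. by have /andP[] := r1k. Qed.
Let r0 : 0 < r. Proof. exact: lt_trans r1. Qed.

Let W_open : open W.
Proof.
have -> : W = V `&` ~` C.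
  rewrite E_def; apply/seteqP; split=> x [Vx h]; split=> //; last by case.
  by move=> Cx; exact: h.
by apply: openI => //; exact: closed_openC.
Qed.

Let E_lnull : lebesgue_outer E = 0%E.
Proof.
have /andP[s0 sn] := s0n; apply: hausdorff_null_lebesgue_null E_null => //.
by apply: le_trans sn _; rewrite gerBl ltW.
Qed.

Let mV : lmeasurable V. Proof. exact: open_lebesgue_measurable. Qed.
Let mW : lmeasurable W. Proof. exact: open_lebesgue_measurable. Qed.
Let mE : lmeasurable E. Proof. exact: null_lebesgue_measurable. Qed.

(** Cutoffs as in [null_cutoff] for the part of [E] in the support of [phi]:
    multiplied by them, [phi] becomes a test function on [W]. *)
Lemma removable_cutoffs (phi : 'cV[R]_n -> R) : test_function V phi ->
  exists chi : nat -> 'cV[R]_n -> R,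
    [/\ forall l, smoothR (chi l), forall l x, 0 <= chi l x <= 1,
      forall l, test_function W (fun x => phi x * chi l x),
      forall x, W x -> \forall l \near \oo, chi l x = 1 &
      forall l j, (\int[mu]_x (`|partialR j (chi l) x| `^ r)%:E <= 1%:E)%E /\
                  (\int[mu]_x (`|partialR j (chi l) x|)%:E <= (l.+1%:R^-1)%:E)%E].
Proof.
move=> [sphi cphi phiV]; pose T := supp phi `&` C.
have cT : compact T.
  apply: subclosed_compact cphi _; last by move=> x [].
  by apply: closedI => //; exact: closed_closure.
have TE : T `<=` E by move=> x [/phiV Vx Cx]; rewrite E_def.
have e0 l : 0 < l.+1%:R^-1 :> R by rewrite invr_gt0.
have /choice[chi hchi] := fun l => null_cutoff k1 r1k s0n E_null cT TE (e0 l).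
exists chi; split.
- by move=> l; have [] := hchi l.
- by move=> l x; have [] := hchi l.
- move=> l; have [schi _ [U [oU TU U0]] _ _] := hchi l.
  have sub : supp (fun x => phi x * chi l x) `<=` supp phi.
    apply: closure_subset => x /=; apply: contra_neq => ->.
    by rewrite mul0r.
  apply: test_functionP.
  + exact (smoothM sphi schi).
  + by apply: subclosed_compact cphi sub; exact: closed_closure.
  + move=> x hx; have Vx := phiV _ (sub _ hx); split=> // Ex.
    have Cx : C x by move: Ex; rewrite E_def => -[].
    have Ux : nbhs x U by apply: open_nbhs_nbhs; split=> //; apply: TU; split=> //; exact: sub.
    have [y [/= py Uy]] := hx U Ux.
    by move/eqP: py; rewrite U0// mulr0.
- move=> x [Vx Ex].
  have : nbhs x (~` T).
    apply: open_nbhs_nbhs; split; last by move=> /TE.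
    by apply: closed_openC; apply: compact_closed => //; exact: hausdorff_cV.
  move=> /nbhs_ballP[d /= d0 dT].
  near=> l; have [_ _ _ + _] := hchi l; apply => y Ty yx.
  apply: (dT y) => //; split=> // i j; rewrite (ord1 j).
  apply: le_lt_trans (yx i) _.
  have : l.+1%:R^-1 < d / 2.
    near: l; have [N hN] := @ltr_add_invr R 0 (d / 2) ltac:(by rewrite divr_gt0).
    exists N => // l /= Nl; rewrite add0r in hN; apply: le_lt_trans hN.
    by rewrite lef_pV2 ?posrE// ler_nat.
  by move=> h; rewrite mulrC -ltr_pdivlMr.
- move=> l j; have [_ _ _ _ /(_ j)[h1 h2]] := hchi l; split=> //.
  by apply: le_trans h1 _; rewrite lee_fin invf_le1// ler1n.
Unshelve. all: by end_near. Qed.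

Variables (v : 'cV[R]_n -> 'cV[R]_m) (v' : 'cV[R]_n -> 'M[R]_(m, n)).
Variable M : R.
Hypothesis v_bounded : ae_in W (fun x => enorm (v x) <= M).
Hypothesis v_sobolev : sobolev_loc r W v v'.

Let v_le : {ae mu, forall x, W x -> forall i, `|v x i 0| <= `|M|}.
Proof.
have vb : {ae mu, forall x, W x -> enorm (v x) <= M} := v_bounded.
apply: (ae_mono vb) => x h Wx i.
by apply: le_trans (coord_le_enorm _ i) (le_trans (h Wx) (ler_norm _)).
Qed.

Let mv i : lmeasurable_fun W (fun x => v x i 0).
Proof. by have [/(_ i)[]] := v_sobolev. Qed.

Let mv' i j : lmeasurable_fun W (fun x => v' x i j).
Proof. by have [_ /(_ i j)[]] := v_sobolev. Qed.

Lemma measurable_fun_fill (f : 'cV[R]_n -> R) :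
  lmeasurable_fun W f -> lmeasurable_fun V f.
Proof.
move=> mf; have -> : V = W `|` E.
  apply/seteqP; split=> [x Vx|x [[]//|]]; last by rewrite E_def => -[].
  by have [Ex|Ex] := pselect (E x); [right|left].
apply/(@measurable_funU _ _ (lebesgue_space R n) _ W E f mW mE); split=> //.
exact: null_lmeasurable_fun.
Qed.

Lemma ge0_integral_removable (D : set 'cV[R]_n) (f : 'cV[R]_n -> R) :
  lmeasurable D -> lmeasurable_fun D f -> (forall x, 0 <= f x) ->
  (\int[mu]_(x in D) (f x)%:E = \int[mu]_(x in D `\` E) (f x)%:E)%E.
Proof.
move=> mD mf f0.
have mfE : measurable_fun (D : set (lebesgue_space R n)) (fun x => (f x)%:E).
  exact/measurable_EFinP.
have f0E (x : lebesgue_space R n) : D x -> (0 <= (f x)%:E)%E by rewrite lee_fin.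
have muE : mu E = 0%E := E_lnull.
exact (ge0_negligible_integral mE mD mfE f0E muE).
Qed.

Lemma removable_Lp_loc_v i : Lp_loc r V (fun x => v x i 0).
Proof.
split; first exact: measurable_fun_fill.
move=> S cS SV; have mS := compact_lmeasurable cS.
have mvS := measurable_funS mV SV (measurable_fun_fill (mv i)).
have SEW : S `\` E `<=` W by move=> x [/SV Vx Ex].
rewrite (ge0_integral_removable mS (powR_norm_lmeasurable_fun r mvS) (fun x => powR_ge0 _ _)).
have mSE : lmeasurable (S `\` E) by exact: (measurableD mS mE).
apply: (@le_lt_trans _ _ (\int[mu]_(x in S `\` E) (`|M| `^ r)%:E)%E).
  apply: (@ae_ge0_le_integral _ (lebesgue_space R n) R mu (S `\` E) mSE).
  - by move=> x _; rewrite lee_fin powR_ge0.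
  - apply/measurable_EFinP; apply: powR_norm_lmeasurable_fun.
    exact: (measurable_funS mW SEW (mv i)).
  - by move=> x _; rewrite lee_fin powR_ge0.
  - exact: measurable_cst.
  - apply: (ae_mono v_le) => x h /SEW Wx; rewrite lee_fin.
    by apply: ge0_ler_powR; rewrite ?nnegrE ?(ltW r0)//; exact: h.
rewrite integral_cst//; apply: lte_mul_pinfty; rewrite ?lee_fin ?powR_ge0//.
apply: le_lt_trans (compact_lebesgue_lty cS).
by apply: le_lebesgue_outer => x [].
Qed.

Variable cc : R.
Hypothesis cc0 : 0 < cc.
Hypothesis caccioppoli : forall psi, test_function W psi ->
  (Lnorm_mx r W (fun x => psi x *: v' x) <=
    cc%:E * Lnorm_mx r W (tensor_grad v psi))%E.

Lemma test_function_energy (phi : 'cV[R]_n -> R) : test_function V phi ->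
  exists2 D : R, 0 <= D & forall j, (\int[mu]_x (`|partialR j phi x| `^ r)%:E <= D%:E)%E.
Proof.
move=> [sphi cphi _].
suff /choice[D hD] : forall j, exists D : R, 0 <= D /\
    (\int[mu]_x (`|partialR j phi x| `^ r)%:E <= D%:E)%E.
  exists (\sum_j D j) => [|j]; first by apply: sumr_ge0 => j _; exact: (hD j).1.
  apply: le_trans (hD j).2 _; rewrite lee_fin (bigD1 j)//= lerDl.
  by apply: sumr_ge0 => l _; exact: (hD l).1.
move=> j.
have [A A0 hA] := continuous_bounded_on cphi
  (smoothR_continuous (smoothR_partialR j sphi)) (fun x h => partial_supp0 j h).
have mS := compact_lmeasurable cphi.
have S_fin : mu (supp phi) \is a fin_num.
  by rewrite ge0_fin_numE ?compact_lebesgue_lty.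
exists (A `^ r * fine (mu (supp phi))); split.
  by rewrite mulr_ge0 ?powR_ge0// fine_ge0.
apply: (@le_trans _ _ (\int[mu]_x ((A `^ r)%:E * (\1_(supp phi) x)%:E))%E).
  apply: ge0_le_integralT => x; first by rewrite lee_fin powR_ge0.
  rewrite -EFinM lee_fin; apply: le_trans (_ : (A * \1_(supp phi) x) `^ r <= _).
    by apply: ge0_ler_powR; rewrite ?nnegrE ?(ltW r0) ?mulr_ge0 ?(ltW A0)//; exact: hA.
  rewrite indicE; case: (_ \in _); first by rewrite !mulr1.
  by rewrite !mulr0 powR0// gt_eqF.
have m1 : measurable_fun setT
    ((fun x => (\1_(supp phi) x)%:E) : lebesgue_space R n -> \bar R).
  by apply/measurable_EFinP; apply: measurable_indic; exact: mS.
rewrite ge0_integralZl_EFin ?powR_ge0//.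
by rewrite integral_indic// setIT EFinM fineK.
Qed.

Definition grad_power (chi phi : 'cV[R]_n -> R) (x : 'cV[R]_n) : R :=
  \sum_j (`|partialR j chi x| `^ r + `|partialR j phi x| `^ r).

(** The Leibniz rule and the boundedness of [v] separate the gradients of the
    two factors of the test function. *)
Lemma tensor_grad_le (chi phi : 'cV[R]_n -> R) x :
  smoothR chi -> smoothR phi -> 0 <= chi x <= 1 -> 0 <= phi x <= 1 ->
  (forall i, `|v x i 0| <= `|M|) ->
  ((\sum_i `|v x i 0|) * \sum_j `|partialR j (fun x => phi x * chi x) x|) `^ r <=
  (m%:R * `|M|) `^ r * (n%:R `^ r * 2 `^ r) * grad_power chi phi x.
Proof.
move=> schi sphi /andP[c0 c1] /andP[p0 p1] vM.
have a0 : 0 <= \sum_i `|v x i 0| by exact: sumr_ge0.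
have b0 : 0 <= \sum_j `|partialR j (fun x => phi x * chi x) x| by exact: sumr_ge0.
rewrite powRM// -mulrA ler_pM ?powR_ge0//.
  apply: ge0_ler_powR; rewrite ?nnegrE ?(ltW r0) ?mulr_ge0//.
  apply: le_trans (ler_sum _ (fun i _ => vM i)) _.
  by rewrite sumr_const card_ord mulr_natl.
apply: (@le_trans _ _ ((\sum_j (`|partialR j chi x| + `|partialR j phi x|)) `^ r)).
  apply: ge0_ler_powR; rewrite ?nnegrE ?(ltW r0) ?sumr_ge0//.
  apply: ler_sum => j _; rewrite (partialM j x sphi schi).
  apply: le_trans (ler_normD _ _) _; rewrite !normrM (ger0_norm p0) (ger0_norm c0).
  by apply: lerD; rewrite ler_piMl.
apply: le_trans (powR_sum_le r0 _) _; first by move=> j; rewrite addr_ge0.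
rewrite card_ord -mulrA ler_wpM2l ?powR_ge0// mulr_sumr.
apply: ler_sum => j _.
have := @powR_sum_le R bool r (fun b => if b then `|partialR j chi x| else `|partialR j phi x|) r0 _.
by rewrite card_bool !big_bool/=; apply; case.
Qed.

(** The Caccioppoli inequality for [phi] times a cutoff bounds the energy off a
    neighbourhood of [E] independently of that neighbourhood, because the right
    side only involves [v], which is bounded, and gradients of test functions.
    Fatou's lemma then removes the cutoff. *)
Lemma removable_energy (phi : 'cV[R]_n -> R) i j : test_function V phi ->
  (forall x, 0 <= phi x <= 1) ->
  (\int[mu]_(x in W) (`|phi x * v' x i j| `^ r)%:E < +oo)%E.
Proof.
move=> tphi phi01; have [sphi cphi phiV] := tphi.
have [D D0 hD] := test_function_energy tphi.
have [chi [schi chi01 tchi chi1 chiE]] := removable_cutoffs tphi.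
pose c1 : R := (m%:R * `|M|) `^ r * (n%:R `^ r * 2 `^ r).
have c10 : 0 <= c1 by rewrite !mulr_ge0 ?powR_ge0.
pose B : R := c1 * (n%:R * (1 + D)).
have B0 : 0 <= B by rewrite !mulr_ge0 ?addr_ge0.
pose g l x : R := (\sum_i `|v x i 0|) * \sum_j `|partialR j (fun x => phi x * chi l x) x|.
have mp (f : 'cV[R]_n -> R) (A : set 'cV[R]_n) q : smoothR f ->
    lmeasurable_fun A (fun x => `|partialR q f x| `^ r).
  move=> sf; apply: powR_norm_lmeasurable_fun; apply: continuous_lmeasurable_fun.
  exact (smoothR_continuous (smoothR_partialR q sf)).
have mG (A : set 'cV[R]_n) l : lmeasurable_fun A (grad_power (chi l) phi).
  apply: (@measurable_sum _ (lebesgue_space R n)) => q.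
  exact (measurable_funD (mp _ A q (schi l)) (mp _ A q sphi)).
have G0 l x : 0 <= grad_power (chi l) phi x.
  by apply: sumr_ge0 => q _; rewrite addr_ge0 ?powR_ge0.
have gB l : (\int[mu]_(x in W) (g l x `^ r)%:E <= B%:E)%E.
  apply: (@le_trans _ _ (\int[mu]_(x in W) (c1 * grad_power (chi l) phi x)%:E)%E).
    apply: (@ae_ge0_le_integral _ (lebesgue_space R n) R mu W mW).
    - by move=> x _; rewrite lee_fin powR_ge0.
    - apply/measurable_EFinP.
      have mg : lmeasurable_fun W (g l).
        apply: (@measurable_funM _ (lebesgue_space R n)).
          apply: (@measurable_sum _ (lebesgue_space R n)) => q.
          exact (measurableT_comp (@normr_measurable R setT) (mv q)).
        apply: (@measurable_sum _ (lebesgue_space R n)) => q.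
        exact (measurableT_comp (@normr_measurable R setT) (@continuous_lmeasurable_fun R n W _
          (smoothR_continuous (smoothR_partialR q (smoothM sphi (schi l)))))).
      exact (measurableT_comp (measurable_powR r) mg).
    - by move=> x _; rewrite lee_fin mulr_ge0.
    - by apply/measurable_EFinP; exact (measurable_funM (measurable_cst c1) (mG W l)).
    - apply: (ae_mono v_le) => x h Wx; rewrite lee_fin.
      exact (tensor_grad_le (schi l) sphi (chi01 l x) (phi01 x) (h Wx)).
  apply: (@le_trans _ _ (\int[mu]_x (c1 * grad_power (chi l) phi x)%:E)%E).
    exact (ge0_le_integral_subset mW measurableT (@subsetT _ _)
      (measurable_funM (measurable_cst c1) (mG setT l)) (fun x => mulr_ge0 c10 (G0 l x))).
  under eq_integral do rewrite EFinM.
  have mGE : measurable_fun (setT : set (lebesgue_space R n)) (fun x => (grad_power (chi l) phi x)%:E).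
    by apply/measurable_EFinP; exact: mG.
  have G0E (x : lebesgue_space R n) : setT x -> (0 <= (grad_power (chi l) phi x)%:E)%E.
    by rewrite lee_fin.
  rewrite (ge0_integralZl_EFin mu measurableT G0E mGE c10).
  have -> : B%:E = (c1%:E * (n%:R * (1 + D))%:E)%E by rewrite -EFinM.
  rewrite lee_wpmul2l ?lee_fin//.
  under eq_integral do rewrite /grad_power -sumEFin.
  have mpE q : measurable_fun (setT : set (lebesgue_space R n)) (fun x =>
      (`|partialR q (chi l) x| `^ r + `|partialR q phi x| `^ r)%:E).
    by apply/measurable_EFinP; exact (measurable_funD (mp _ setT q (schi l)) (mp _ setT q sphi)).
  have p0E q (x : lebesgue_space R n) : setT x ->
      (0 <= (`|partialR q (chi l) x| `^ r + `|partialR q phi x| `^ r)%:E)%E.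
    by move=> _; rewrite lee_fin addr_ge0 ?powR_ge0.
  rewrite (ge0_integral_sum mu measurableT mpE p0E).
  have -> : n%:R * (1 + D) = \sum_(q < n) (1 + D).
    by rewrite sumr_const card_ord mulr_natl.
  rewrite -sumEFin; apply: lee_sum => q _.
  under eq_integral do rewrite EFinD.
  have m1E : measurable_fun (setT : set (lebesgue_space R n)) (fun x => (`|partialR q (chi l) x| `^ r)%:E).
    by apply/measurable_EFinP; exact (mp _ setT q (schi l)).
  have m2E : measurable_fun (setT : set (lebesgue_space R n)) (fun x => (`|partialR q phi x| `^ r)%:E).
    by apply/measurable_EFinP; exact (mp _ setT q sphi).
  have z1 (x : lebesgue_space R n) : setT x -> (0 <= (`|partialR q (chi l) x| `^ r)%:E)%E.
    by move=> _; rewrite lee_fin powR_ge0.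
  have z2 (x : lebesgue_space R n) : setT x -> (0 <= (`|partialR q phi x| `^ r)%:E)%E.
    by move=> _; rewrite lee_fin powR_ge0.
  rewrite (ge0_integralD mu measurableT z1 m1E z2 m2E) EFinD.
  by apply: leeD; [exact: (chiE l q).1|exact: hD].
pose B2 := cc * B `^ r^-1.
have B20 : 0 <= B2 by rewrite mulr_ge0 ?powR_ge0 ?ltW.
have bound l : (\int[mu]_(x in W) (`|phi x * chi l x * v' x i j| `^ r)%:E <= (B2 `^ r)%:E)%E.
  have h : (Lnorm_mx r W (fun x => (phi x * chi l x) *: v' x) <= B2%:E)%E.
    apply: le_trans (caccioppoli (tchi l)) _; rewrite /B2 EFinM lee_wpmul2l ?lee_fin ?(ltW cc0)//.
    apply: (@Lnorm_mx_le R m n r B W _ (g l) r0 B0 _ (gB l)) => x Wx.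
    apply: le_trans (opnorm_le_sum _) _; rewrite /g mulr_suml.
    apply: ler_sum => p _; rewrite mulr_sumr; apply: ler_sum => q _.
    by rewrite mxE normrM.
  have := le_Lnorm_mx i j r0 B20 h.
  by under eq_integral do rewrite mxE.
apply: le_lt_trans (ltry (B2 `^ r)).
have mf l : measurable_fun (W : set (lebesgue_space R n))
    (fun x => (`|phi x * chi l x * v' x i j| `^ r)%:E).
  apply/measurable_EFinP; apply: powR_norm_lmeasurable_fun.
  apply: (@measurable_funM _ (lebesgue_space R n)); last exact: mv'.
  apply: continuous_lmeasurable_fun.
  exact (smoothR_continuous (smoothM sphi (schi l))).
have f0 l (x : lebesgue_space R n) : W x -> (0 <= (`|phi x * chi l x * v' x i j| `^ r)%:E)%E.
  by move=> _; rewrite lee_fin powR_ge0.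
have hfatou := fatou mu mW mf f0.
apply: le_trans (le_trans hfatou (limn_einf_le bound)).
rewrite le_eqVlt; apply/orP; left; apply/eqP; apply: eq_integral => x /set_mem Wx.
have cv : (fun l => (`|phi x * chi l x * v' x i j| `^ r)%:E) @ \oo --> (`|phi x * v' x i j| `^ r)%:E.
  apply: cvg_near_cst; near=> l.
  have -> : chi l x = 1 by near: l; exact: chi1.
  by rewrite mulr1.
by rewrite (cvg_limn_einf_sup cv).1.
Unshelve. all: by end_near. Qed.

Lemma removable_Lp_loc_grad i j : Lp_loc r V (fun x => v' x i j).
Proof.
split; first exact: measurable_fun_fill.
move=> S cS SV; have mS := compact_lmeasurable cS.
have [phi tphi [phi01 phi1]] := compact_plateau V_open cS SV.
have mS' := measurable_funS mV SV (measurable_fun_fill (mv' i j)).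
have SEW : S `\` E `<=` W by move=> x [/SV Vx Ex].
rewrite (ge0_integral_removable mS (powR_norm_lmeasurable_fun r mS') (fun x => powR_ge0 _ _)).
have mSE : lmeasurable (S `\` E) by exact: (measurableD mS mE).
apply: le_lt_trans (removable_energy i j tphi phi01).
have -> : (\int[mu]_(x in S `\` E) (`|v' x i j| `^ r)%:E =
    \int[mu]_(x in S `\` E) (`|phi x * v' x i j| `^ r)%:E)%E.
  by apply: eq_integral => x /set_mem[Sx _]; rewrite phi1// mul1r.
have [sphi _ _] := tphi.
have mphi := @continuous_lmeasurable_fun R n W _ (smoothR_continuous sphi).
exact (ge0_le_integral_subset mSE mW SEW
  (powR_norm_lmeasurable_fun r (measurable_funM mphi (mv' i j))) (fun x => powR_ge0 _ _)).
Qed.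

(** The only term that the cutoff adds when one integrates by parts. *)
Lemma cutoff_commutator_le (phi chi : 'cV[R]_n -> R) (A e : R) i j :
  lmeasurable_fun W (fun x => v x i 0 * (phi x * partialR j chi x)) ->
  smoothR chi -> 0 <= A -> (forall x, `|phi x| <= A) ->
  (\int[mu]_x (`|partialR j chi x|)%:E <= e%:E)%E ->
  (`|\int[mu]_(x in W) (v x i 0 * (phi x * partialR j chi x))%:E| <=
    (`|M| * A * e)%:E)%E.
Proof.
move=> mf schi A0 phiA chie.
have mfE : measurable_fun (W : set (lebesgue_space R n))
    (fun x => (v x i 0 * (phi x * partialR j chi x))%:E) by exact/measurable_EFinP.
have mc (D : set 'cV[R]_n) : lmeasurable_fun D (fun x => `|partialR j chi x|).
  exact (measurableT_comp (@normr_measurable R setT) (@continuous_lmeasurable_fun R n D _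
    (smoothR_continuous (smoothR_partialR j schi)))).
apply: le_trans (le_abse_integral mu mW mfE) _.
apply: (@le_trans _ _ (\int[mu]_(x in W) (`|M| * A * `|partialR j chi x|)%:E)%E).
  apply: (@ae_ge0_le_integral _ (lebesgue_space R n) R mu W mW).
  - by move=> x _; exact: abse_ge0.
  - exact (measurableT_comp (@abse_measurable R setT) mfE).
  - by move=> x _; rewrite lee_fin !mulr_ge0.
  - by apply/measurable_EFinP; exact (measurable_funM (measurable_cst (`|M| * A)) (mc W)).
  - apply: (ae_mono v_le) => x h Wx; rewrite abse_EFin lee_fin !normrM mulrA.
    by rewrite ler_wpM2r// ler_pM//; exact: h.
apply: (@le_trans _ _ (\int[mu]_x (`|M| * A * `|partialR j chi x|)%:E)%E).
  exact (ge0_le_integral_subset mW measurableT (@subsetT _ _)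
    (measurable_funM (measurable_cst (`|M| * A)) (mc setT))
    (fun x => mulr_ge0 (mulr_ge0 (normr_ge0 M) A0) (normr_ge0 _))).
under eq_integral do rewrite EFinM.
have mcE : measurable_fun (setT : set (lebesgue_space R n)) (fun x => (`|partialR j chi x|)%:E).
  by apply/measurable_EFinP; exact: mc.
have c0 (x : lebesgue_space R n) : setT x -> (0 <= (`|partialR j chi x|)%:E)%E.
  by rewrite lee_fin.
rewrite (ge0_integralZl_EFin mu measurableT c0 mcE (mulr_ge0 (normr_ge0 M) A0)).
by rewrite [leRHS]EFinM lee_wpmul2l// lee_fin mulr_ge0.
Qed.

(** With [h] the sum of the two integrands, integration by parts on [W] against
    [phi] times a cutoff says that the integral of [h] times the cutoff equals
    minus the commutator term; the former tends to the integral of [h], the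
    latter to 0. *)
Lemma removable_by_parts i j (phi : 'cV[R]_n -> R) : test_function V phi ->
  (\int[mu]_(x in V) (v x i 0 * partialR j phi x)%:E =
   - \int[mu]_(x in V) (v' x i j * phi x)%:E)%E.
Proof.
move=> tphi; have [sphi cphi phiV] := tphi.
have Lf := removable_Lp_loc_v i; have Lf' := removable_Lp_loc_grad i j.
have r1' := ltW r1.
have WV : W `<=` V by move=> x [].
have cont (g : 'cV[R]_n -> R) : smoothR g -> continuous g by exact: smoothR_continuous.
have intV (f g : 'cV[R]_n -> R) : Lp_loc r V f -> continuous g ->
    (forall x, ~ supp phi x -> g x = 0) -> mu.-integrable V (fun x => (f x * g x)%:E).
  move=> Lpf cg g0; have [A A0 hA] := continuous_bounded_on cphi cg g0.
  exact: (Lp_loc_integrable r1' mV Lpf cphi phiV cg hA).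
have intW (f g : 'cV[R]_n -> R) : Lp_loc r V f -> continuous g ->
    (forall x, ~ supp phi x -> g x = 0) -> mu.-integrable W (fun x => (f x * g x)%:E).
  by move=> Lpf cg g0; exact (integrableS mV mW WV (intV f g Lpf cg g0)).
have dphi0 x : ~ supp phi x -> partialR j phi x = 0 by exact: partial_supp0.
have phi0 x : ~ supp phi x -> phi x = 0 by exact: supp0.
have cdphi := cont _ (smoothR_partialR j sphi).
have I1 := intV _ _ Lf cdphi dphi0.
have I2 := intV _ _ Lf' (cont _ sphi) phi0.
have I1W := integrableS mV mW WV I1; have I2W := integrableS mV mW WV I2.
pose h x := v x i 0 * partialR j phi x + v' x i j * phi x.
have IhW : mu.-integrable W (fun x => (h x)%:E).
  exact (integrableD mW I1W I2W).
have [A A0 hA] := continuous_bounded_on cphi (cont _ sphi) phi0.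
have hA' x : `|phi x| <= A.
  apply: le_trans (hA x) _; rewrite indicE; case: (_ \in _); first by rewrite mulr1.
  by rewrite mulr0 ltW.
have [chi [schi chi01 tchi chi1 chiE]] := removable_cutoffs tphi.
have key l : (\int[mu]_(x in W) (h x * chi l x)%:E =
    - \int[mu]_(x in W) (v x i 0 * (phi x * partialR j (chi l) x))%:E)%E.
  have cchi := cont _ (schi l); have cdchi := cont _ (smoothR_partialR j (schi l)).
  have J1 : mu.-integrable W (fun x => (v x i 0 * (phi x * partialR j (chi l) x))%:E).
    have cg : continuous (fun x => phi x * partialR j (chi l) x).
      by move=> x; apply: continuousM; [exact: cont|exact: cdchi].
    by apply: (intW _ _ Lf cg) => x Sx; rewrite phi0// mul0r.
  have J2 : mu.-integrable W (fun x => (v x i 0 * (chi l x * partialR j phi x))%:E).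
    have cg : continuous (fun x => chi l x * partialR j phi x).
      by move=> x; apply: continuousM; [exact: cchi|exact: cdphi].
    by apply: (intW _ _ Lf cg) => x Sx; rewrite dphi0// mulr0.
  have J3 : mu.-integrable W (fun x => (v' x i j * (phi x * chi l x))%:E).
    have cg : continuous (fun x => phi x * chi l x).
      by move=> x; apply: continuousM; [exact: cont|exact: cchi].
    by apply: (intW _ _ Lf' cg) => x Sx; rewrite phi0// mul0r.
  have [_ _ /(_ i j _ (tchi l))] := v_sobolev.
  have -> : (\int[mu]_(x in W) (v x i 0 * partial j (fun x => phi x * chi l x) x)%:E =
      \int[mu]_(x in W) (v x i 0 * (phi x * partialR j (chi l) x))%:E +
      \int[mu]_(x in W) (v x i 0 * (chi l x * partialR j phi x))%:E)%E.
    rewrite -(integralD mW J1 J2); apply: eq_integral => x _; rewrite -EFinD -mulrDr.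
    by congr (_ * _)%:E; exact (partialM j x sphi (schi l)).
  have -> : (\int[mu]_(x in W) (h x * chi l x)%:E =
      \int[mu]_(x in W) (v x i 0 * (chi l x * partialR j phi x))%:E +
      \int[mu]_(x in W) (v' x i j * (phi x * chi l x))%:E)%E.
    rewrite -(integralD mW J2 J3); apply: eq_integral => x _; rewrite -EFinD.
    by congr EFin; rewrite /h; ring.
  have F1 := integrable_fin_num mW J1; have F2 := integrable_fin_num mW J2.
  have F3 := integrable_fin_num mW J3; move: F1 F2 F3.
  set a := (\int[mu]_(x in W) _)%E; set b := (\int[mu]_(x in W) _)%E.
  set c := (\int[mu]_(x in W) _)%E.
  case: a => [a||]//; case: b => [b||]//; case: c => [c||]// _ _ _.
  by rewrite -!EFinD -!EFinN => -[abc]; congr EFin; lra.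
pose u l := (\int[mu]_(x in W) (h x * chi l x)%:E)%E.
have mh : lmeasurable_fun W h by apply/measurable_EFinP; exact: (measurable_int mu IhW).
have u_lim : u @ \oo --> (\int[mu]_(x in W) (h x)%:E)%E.
  have mhc l : measurable_fun (W : set (lebesgue_space R n)) (fun x => (h x * chi l x)%:E).
    apply/measurable_EFinP.
    exact (measurable_funM mh (@continuous_lmeasurable_fun R n W _ (cont _ (schi l)))).
  have mhE := measurable_int mu IhW.
  have cv : {ae mu, forall x, W x -> (h x * chi l x)%:E @[l --> \oo] --> (h x)%:E}.
    apply: aeW => x Wx; apply: cvg_near_cst; near=> l.
    have -> : chi l x = 1 by near: l; exact: chi1.
    by rewrite mulr1.
  have bd : {ae mu, forall x l, W x -> (`|(h x * chi l x)%:E| <= `|(h x)%:E|)%E}.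
    apply: aeW => x l _; rewrite lee_fin normrM ler_piMr//.
    by have /andP[c0 c1] := chi01 l x; rewrite ger0_norm.
  have [_ _] := dominated_convergence mW mhc mhE cv (integrable_abse IhW) bd.
  by [].
have u_le l : (`|u l| <= (`|M| * A * l.+1%:R^-1)%:E)%E.
  have cg : continuous (fun x => phi x * partialR j (chi l) x).
    by move=> x; apply: continuousM; [exact: cont|exact: cont (smoothR_partialR j (schi l)) x].
  have mg := measurable_funM (mv i) (@continuous_lmeasurable_fun R n W _ cg).
  rewrite /u key abseN.
  exact (cutoff_commutator_le mg (schi l) (ltW A0) hA' (chiE l j).2).
have h0 : (\int[mu]_(x in W) (h x)%:E = 0)%E.
  have e0 : (fun l : nat => (`|M| * A * l.+1%:R^-1)%:E) @ \oo --> (0%:E : \bar R).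
    apply: cvg_EFin; first exact: nearW.
    rewrite -[X in _ --> X](mulr0 (`|M| * A)); apply: cvgMr.
    exact: cvg_harmonic.
  have e0N : (fun l : nat => - (`|M| * A * l.+1%:R^-1)%:E)%E @ \oo --> (0%:E : \bar R).
    by rewrite -[X in _ --> X]oppe0; exact: cvgeN.
  have u0 : u @ \oo --> (0%:E : \bar R).
    apply: (squeeze_cvge _ e0N e0); near=> l.
    have := u_le l; case: (u l) => [z||]//; rewrite abse_EFin !lee_fin.
    by rewrite ler_norml.
  exact: (cvg_unique _ u_lim u0).
have VW (f : 'cV[R]_n -> R) : mu.-integrable V (fun x => (f x)%:E) ->
    (\int[mu]_(x in V) (f x)%:E = \int[mu]_(x in W) (f x)%:E)%E.
  by move=> If; have muE : mu E = 0%E := E_lnull; exact (negligible_integral mE mV If muE).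
have E1 := VW _ I1; have E2 := VW _ I2.
transitivity (\int[mu]_(x in W) (v x i 0 * partialR j phi x)%:E)%E; first exact: E1.
rewrite E2.
have hD : (\int[mu]_(x in W) (h x)%:E =
   \int[mu]_(x in W) (v x i 0 * partialR j phi x)%:E +
   \int[mu]_(x in W) (v' x i j * phi x)%:E)%E by rewrite -(integralD mW I1W I2W).
move: h0; rewrite hD.
have F1 := integrable_fin_num mW I1W; have F2 := integrable_fin_num mW I2W; move: F1 F2.
set a := (\int[mu]_(x in W) _)%E; set b := (\int[mu]_(x in W) _)%E.
case: a => [a||]//; case: b => [b||]// _ _.
by rewrite -!EFinD -!EFinN => -[ab]; congr EFin; lra.
Unshelve. all: by end_near. Qed.

Lemma removable : sobolev_loc r V v v'.
Proof.
split=> [i|i j|i j].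
- exact: removable_Lp_loc_v.
- exact: removable_Lp_loc_grad.
- by move=> phi; exact: removable_by_parts.
Qed.

End Removability.

(** * Extension of bounded solutions *)

Lemma ae_fill d (T : measurableType d) (R : realType)
    (mu : {measure set T -> \bar R}) (V E : set T) (P : T -> Prop) :
  mu.-negligible E -> {ae mu, forall x, (V `\` E) x -> P x} ->
  {ae mu, forall x, V x -> P x}.
Proof.
move=> nE aeP; apply: (negligibleS _ (negligibleU aeP nE)) => x /= h.
have [Ex|Ex] := pselect (E x); [by right|left => hP].
by apply: h => Vx; apply: hP.
Qed.

Unset Implicit Arguments.

Theorem theorem3p5 (R : realType) (n m k : nat) (F G : 'M[R]_(m, n) -> R)
    (hk : (2 <= k <= minn n m)%N)
    (F_cont : continuous F) (G_cont : continuous G)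
    (G_null : null_lagrangian G)
    (F_hom : pos_homogeneous k F) (G_hom : pos_homogeneous k G)
    (FG_sup : sup [set L : R | 0 <= L /\ forall A, L * G A <= F A] = 1)
    (F_pos : 0 < inf [set F A | A in [set A | opnorm A = 1]])
    (K : R) (hK : 1 <= K)
    (q : R) (hq : lower_regularity_exponent k F G K q)
    (V E : set 'cV[R]_n)
    (V_open : open V) (V_conn : connected V) (V_ne : V !=set0)
    (E_closed : exists2 C, closed C & E = V `&` C)
    (E_dim : (hausdorff_dim E < (n%:R - q)%:E)%E)
    (v : 'cV[R]_n -> 'cV[R]_m) (v' : 'cV[R]_n -> 'M[R]_(m, n))
    (v_bounded : exists M : R, ae_in (V `\` E) (fun x => enorm (v x) <= M))
    (v_sobolev : sobolev_loc k%:R (V `\` E) v v')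
    (v_ineq : ae_in (V `\` E) (fun x => F (v' x) <= K * G (v' x))) :
  exists (w : 'cV[R]_n -> 'cV[R]_m) (w' : 'cV[R]_n -> 'M[R]_(m, n)),
    [/\ forall x, (V `\` E) x -> w x = v x,
        sobolev_loc k%:R V w w' &
        ae_in V (fun x => F (w' x) <= K * G (w' x))].
Proof.
have [/andP[q1 qk] [pbar [kp [c [c0 hreg]]]]] := hq.
have [C C_closed E_def] := E_closed; have [M v_le] := v_bounded.
have k1 : (1 < k)%N by have /andP[] := hk.
move: E_dim => /ereal_inf_lt[_ [s [s0 sE] <-]]; rewrite lte_fin => sn.
(* Any r with q < r < k and s <= n - r will do. *)
pose r := Num.min ((q + k%:R) / 2) (n%:R - s).
have qr : q < r by rewrite lt_min; apply/andP; split; lra.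
have rk : r < k%:R by rewrite gt_min; apply/orP; left; lra.
have rn : r <= n%:R - s by rewrite ge_min lexx orbT.
have r1k : 1 < r <= k%:R by apply/andP; split; lra.
have s0n : 0 < s <= n%:R - r by apply/andP; split; lra.
have W_open : open (V `\` E).
  have -> : V `\` E = V `&` ~` C.
    rewrite E_def; apply/seteqP; split=> x [Vx h]; split=> //; last by case.
    by move=> Cx; exact: h.
  by apply: openI => //; exact: closed_openC.
have qrp : q < r < pbar by rewrite qr (lt_trans rk kp).
have qkp : q < k%:R < pbar by rewrite qk.
have [v_sobolev_r caccioppoli] := hreg _ _ _ _ qk W_open v_sobolev v_ineq r qrp.
have V_sobolev := removable V_open C_closed E_def k1 r1k s0n sE v_le v_sobolev_r
  (c0 r qrp) caccioppoli.
have E_null : lebesgue_outer E = 0%E.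
  by apply: hausdorff_null_lebesgue_null sE => //; lra.
have V_ineq : ae_in V (fun x => F (v' x) <= K * G (v' x)).
  apply: ae_fill v_ineq.
  have mE : @measurable _ (lebesgue_space R n) E by exact: null_lebesgue_measurable.
  by apply/(negligibleP _ mE).
exists v, v'; split; [by [] | | exact: V_ineq].
exact: (hreg _ _ _ _ qr V_open V_sobolev V_ineq k%:R qkp).1.
Qed.
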